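(* Let $(\theta_n)_{n\in\mathbb{N}_0}$ be the dynamical system defined in the context and put $v_n=\sqrt{\gamma_n}\,\sigma_n$. Assume: (a) there exist $L,L'\in(0,\infty)$ such that for all $\theta\in\mathbb{R}^d$: $\langle\theta-\theta^*,f(\theta)\rangle\le-L\|\theta-\theta^*\|^2$ and $\langle\theta-\theta^*,f(\theta)\rangle\le-L'\|f(\theta)\|^2$; (b) $\sup_{n\in\mathbb{N}}\operatorname{ess\,sup}\|R_n\|<\infty$ and $\sup_{n\in\mathbb{N}}\mathbb{E}[\|D_n\|^p]<\infty$; (c) $v_n>0$ for all $n\in\mathbb{N}$ and, with $L$ from (a), there exist $c_1,c_2,\eta_1\in(0,\infty)$ and $\eta_2\in(0,1]$ with $\eta_1>(1-\eta_2)/p$ such that (i) $\limsup_{n\to\infty}\frac{\varepsilon_n}{v_n}<\infty$, (ii) $\limsup_{n\to\infty}\frac1{\gamma_n}\frac{v_{n-1}-v_n}{v_{n-1}}<L$ and $v_n\le\frac{c_1}{n^{\eta_1}}$ for all but finitely many $n\in\mathbb{N}$, (iii) $\gamma_n\le\frac{c_2}{n^{\eta_2}}$ for all but finitely many $n\in\mathbb{N}$. Let $\eta^*=\eta_1-(1-\eta_2)/p$. Then for all $\eta\in(0,\eta^* )$ there exist a constant $\kappa\in(0,\infty)$ and $n_0\in\mathbb{N}$ such that for all $k_0\ge n_0$ \[ \mathbb{E}\Bigl[\sup_{k\ge k_0}k^{p\eta}\|\theta_k-\theta^*\|^p\Bigr]^{1/p}\le\kappa\,k_0^{-(\eta^*-\eta)}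 . \]
   Context: Fix $p\in[2,\infty)$, a probability space $(\Omega,\mathcal{F},P)$ with a filtration $(\mathcal{F}_n)_{n\in\mathbb{N}_0}$, a scalar product $\langle\cdot,\cdot\rangle$ on $\mathbb{R}^d$ with induced norm $\|\cdot\|$, and a measurable function $f\colon\mathbb{R}^d\to\mathbb{R}^d$ with a unique zero $\theta^*\in\mathbb{R}^d$. The adapted $\mathbb{R}^d$-valued dynamical system $(\theta_n)_{n\in\mathbb{N}_0}$ is defined by a fixed deterministic $\theta_0\in\mathbb{R}^d$ and \[ \theta_n=\theta_{n-1}+\gamma_n\bigl(f(\theta_{n-1})+\varepsilon_nR_n+\sigma_nD_n\bigr),\qquad n\in\mathbb{N}, \] where $(R_n)_{n\in\mathbb{N}}$ is an $\mathbb{R}^d$-valued previsible process ($R_n$ is $\mathcal{F}_{n-1}$-measurable), $(D_n)_{n\in\mathbb{N}}$ is a sequence of $\mathbb{R}^d$-valued martingale differences with respect to $(\mathcal{F}_n)$, $(\gamma_n)_{n\in\mathbb{N}}$ is a sequence of positive reals tending to zero, and $(\varepsilon_n)_{n\in\mathbb{N}}$, $(\sigma_n)_{n\in\mathbb{N}}$ are sequences of non-negative reals. *)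

(* Defs.v *)
From HB Require Import structures.
From mathcomp Require Export all_boot all_order all_algebra.
From mathcomp Require Export all_classical all_reals all_analysis.
From mathcomp Require Export ess_sup_inf.

Set Implicit Arguments.
Unset Strict Implicit.
Unset Printing Implicit Defensive.

Export Order.TTheory GRing.Theory Num.Theory.
Export numFieldNormedType.Exports.

Local Open Scope classical_set_scope.
Local Open Scope ring_scope.

Definition ipnorm (R : realType) (d : nat)
    (ip : {dot 'rV[R]_d for idfun}) (x : 'rV[R]_d) : R :=
  Num.sqrt (ip x x).

(* The topology on ['rV[R]_d] is that of the sup norm, hence the topology
   induced by any scalar product. *)
Definition borel_rV (R : realType) (d : nat) : set (set 'rV[R]_d) :=
  <<s [set U : set 'rV[R]_d | open U] >>.

(* Measurability with respect to an explicit sigma-algebra G on the source;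
   the type of the source carries only one canonical sigma-algebra, so the
   members of a filtration have to be passed around as sets of sets. *)
Definition vec_measurable (R : realType) (d : nat) (T : Type)
    (G : set (set T)) (X : T -> 'rV[R]_d) : Prop :=
  forall B : set 'rV[R]_d, borel_rV B -> G (X @^-1` B).

Record is_filtration (disp : measure_display) (T : measurableType disp)
    (F : nat -> set (set T)) : Prop := IsFiltration {
  filtration_sigma_algebra : forall n, sigma_algebra [set: T] (F n);
  filtration_measurable : forall n, F n `<=` measurable;
  filtration_nondecreasing : forall m n, (m <= n)%N -> F m `<=` F n }.

Definition vec_integrable (R : realType) (d : nat) (disp : measure_display)
    (T : measurableType disp) (P : probability T R) (X : T -> 'rV[R]_d) : Prop :=
  forall i : 'I_d, P.-integrable [set: T] (fun w => (X w ord0 i)%:E).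

(* Y is a version of E[X | G]; integrals of vectors are taken coordinatewise. *)
Record is_cond_expectation (R : realType) (d : nat) (disp : measure_display)
    (T : measurableType disp) (P : probability T R) (G : set (set T))
    (X Y : T -> 'rV[R]_d) : Prop := IsCondExpectation {
  cond_expectation_arg_integrable : vec_integrable P X;
  cond_expectation_integrable : vec_integrable P Y;
  cond_expectation_measurable : vec_measurable G Y;
  cond_expectation_integral : forall A, G A -> forall i : 'I_d,
    (\int[P]_(w in A) (Y w ord0 i)%:E = \int[P]_(w in A) (X w ord0 i)%:E)%E }.

(* Processes indexed by {1, 2, ...} are functions on nat whose value at 0 is
   irrelevant. *)
Definition previsible (R : realType) (d : nat) (T : Type)
    (F : nat -> set (set T)) (X : nat -> T -> 'rV[R]_d) : Prop :=
  forall n, (0 < n)%N -> vec_measurable (F n.-1) (X n).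

Definition martingale_differences (R : realType) (d : nat)
    (disp : measure_display) (T : measurableType disp) (P : probability T R)
    (F : nat -> set (set T)) (D : nat -> T -> 'rV[R]_d) : Prop :=
  forall n, (0 < n)%N ->
    vec_measurable (F n) (D n) /\
    is_cond_expectation P (F n.-1) (D n) (fun=> 0).

Record is_dynamical_system (R : realType) (d : nat) (T : Type)
    (f : 'rV[R]_d -> 'rV[R]_d) (gamma eps sigma : nat -> R)
    (Rb D : nat -> T -> 'rV[R]_d) (theta0 : 'rV[R]_d)
    (theta : nat -> T -> 'rV[R]_d) : Prop := IsDynamicalSystem {
  dynamical_system_init : forall w, theta 0%N w = theta0;
  dynamical_system_step : forall n, (0 < n)%N -> forall w,
    theta n w = theta n.-1 w + gamma n *:
      (f (theta n.-1 w) + eps n *: Rb n w + sigma n *: D n w) }.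

(* Main.v *)
From mathcomp Require Import ring lra measurable_realfun.
Require Import Defs.

Local Open Scope classical_set_scope.
Local Open Scope ring_scope.

(* Write x_n = theta_n - theta^*. The drift contracts |x| by a factor
   1 - L1 gamma_n with L1 < L, and v decays more slowly than that, so expanding
   |x_n|^p to second order around the F_(n-1)-measurable part of x_n gives
   E|x_n|^p <= K v_n^p by induction.

   The supremum is handled through the discounted running maximum
   m_n = max((1 - a gamma_n) m_(n-1), |x_n|). Since |x_n| loses at most
   C gamma_n (|x_(n-1)| + v_n) per step up to a martingale difference, the
   Azema-Yor expression (p - 1) m^p - p m^(p-1) |x| satisfies the same kind of
   linear recursion when a is large, whence E m_n^p <= K v_n^p as well.

   Finally m_n^p >= (1 - p a gamma_n) m_(n-1)^p, so telescoping bounds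
   k^(p eta) m_k^p, for all k0 <= k <= N at once, by
   N^(p eta) m_N^p + p a sum_(k0 <= j < N) (j+1)^(p eta) gamma_(j+1) m_j^p.
   Its expectation is of order k0^(- p (eta^* - eta)), uniformly in N, and
   Fatou's lemma concludes. *)

(** * Power inequalities *)

(** Every error has to carry exactly one factor [gamma]. Since [gamma * sigma = sqrt gamma * v], the
    square of the noise has size [gamma * v ^ 2], while its linear part is centred. Only the
    unconditional moment of [|D_n|] is bounded, so the mixed term [|y|^(p-2) |u|^2] is split
    pointwise by Young's inequality into a small multiple of [gamma |y|^p] and a multiple of
    [gamma v^p |D|^p].

    Three rates [L2 < L1 < L] organise the constants: [v] loses at most the factor [1 - gamma L2]
    per step, the drift contracts by [1 - gamma L1], and the gap [L1 - L2] pays for bias and noise.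
    The second half of (a) absorbs [gamma^2 |f|^2] in the upper estimate and gives [f] linear growth
    for the lower one.

    The exponent [eta^*] is read off the final sum: [j^(p eta) gamma_j v_j^p] is at most of order
    [j^(p eta - eta2 - p eta1) = j^(-(1 + delta))] with [delta = p (eta^* - eta)], so the tail from
    [k0] is of order [k0^(-delta)], and a [p]-th root gives the rate. *)

Section PowerInequalities.
Set Implicit Arguments.
Unset Strict Implicit.
Variable R : realType.
Implicit Types (a b q x y t p m s : R).

Lemma ge0_lerpowR q x y : 0 <= q -> 0 <= x -> x <= y -> x `^ q <= y `^ q.
Proof.
move=> q0 x0 xy; apply: ge0_ler_powR => //; rewrite nnegrE //.
exact: le_trans xy.
Qed.

Lemma powR_pred_mul q x : 1 <= q -> 0 <= x -> x `^ (q - 1) * x = x `^ q.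
Proof. by move=> q1 x0; rewrite mulrC mulr_powRB1 // (lt_le_trans ltr01). Qed.

(** Convexity of the power function as a supporting line at [y], obtained from Young's inequality
    for [x] and [y ^ (q - 1)] with exponents [q] and [q / (q - 1)]. Bernoulli, Jensen, the weighted
    Young inequalities, the Azema-Yor step and the comparison of series all reduce to it. *)
Lemma powR_tangent q x y : 1 <= q -> 0 <= x -> 0 <= y ->
  q * y `^ (q - 1) * x <= x `^ q + (q - 1) * y `^ q.
Proof.
move=> q1 x0 y0.
have [->|qn1] := eqVneq q 1.
  by rewrite subrr powRr0 mul0r addr0 powRr1 // !mul1r.
have q1' : 1 < q by rewrite lt_neqAle eq_sym qn1.
have q0 : 0 < q by lra.
have r0 : 0 < q / (q - 1) by rewrite divr_gt0 // subr_gt0.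
have := @conjugate_powR R x (y `^ (q - 1)) q (q / (q - 1)) x0 (powR_ge0 _ _) q0 r0.
have -> : (y `^ (q - 1)) `^ (q / (q - 1)) = y `^ q.
  by rewrite -powRrM; congr (_ `^ _); field; rewrite subr_eq0.
have -> : q^-1 + (q / (q - 1))^-1 = 1 by field; rewrite subr_eq0 qn1 gt_eqF.
move=> /(_ erefl); rewrite -(ler_pM2l q0) => h.
have -> : q * y `^ (q - 1) * x = q * (x * y `^ (q - 1)) by ring.
apply: le_trans h _; rewrite le_eqVlt; apply/orP; left; apply/eqP.
by field; rewrite subr_eq0 qn1 gt_eqF.
Qed.

Lemma powR_bernoulli q t : 1 <= q -> 0 <= t <= 1 -> 1 - q * t <= (1 - t) `^ q.
Proof.
move=> q1 /andP[t0 t1].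
have := @powR_tangent q (1 - t) 1 q1; rewrite !powR1 => h.
have : q * 1 * (1 - t) <= (1 - t) `^ q + (q - 1) * 1 by apply: h => //; lra.
by lra.
Qed.

(** Average the supporting lines at [c], evaluated at [x] and at [y]: the linear parts recombine to
    [q * c ^ q]. *)
Lemma powR_convex q t x y : 1 <= q -> 0 <= t <= 1 -> 0 <= x -> 0 <= y ->
  ((1 - t) * x + t * y) `^ q <= (1 - t) * x `^ q + t * y `^ q.
Proof.
move=> q1 /andP[t0 t1] x0 y0.
set c := (1 - t) * x + t * y.
have c0 : 0 <= c by rewrite addr_ge0 // mulr_ge0 //; lra.
have hx := powR_tangent q1 x0 c0; have hy := powR_tangent q1 y0 c0.
have hc := powR_pred_mul q1 c0.
set u := c `^ (q - 1) in hx hy hc.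
have : (1 - t) * (q * u * x) + t * (q * u * y) <=
    (1 - t) * (x `^ q + (q - 1) * c `^ q) + t * (y `^ q + (q - 1) * c `^ q).
  by rewrite lerD // ler_wpM2l //; lra.
have -> : (1 - t) * (q * u * x) + t * (q * u * y) = q * c `^ q.
  by rewrite -hc /c; ring.
by lra.
Qed.

(** The supporting line at [x], evaluated at [y / e] and multiplied by [e]; the remaining factors
    [1 / q] and [(q - 1) / q] are bounded by 1. The free weight [e] makes the [x] term as small a
    fraction of the contraction as desired. *)
Lemma powR_young q e x y : 1 <= q -> 0 < e -> 0 <= x -> 0 <= y ->
  x `^ (q - 1) * y <= e * x `^ q + e^-1 `^ (q - 1) * y `^ q.
Proof.
move=> q1 e0 x0 y0.
have ie0 : 0 < e^-1 by rewrite invr_gt0.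
have := @powR_tangent q (e^-1 * y) x q1 (mulr_ge0 (ltW ie0) y0) x0.
rewrite powRM ?(ltW ie0) // -(powR_pred_mul q1 (ltW ie0)).
set k := e^-1 `^ (q - 1); set u := x `^ (q - 1) => h.
have {}h : q * (u * y) <= k * y `^ q + (q - 1) * (e * x `^ q).
  rewrite -(ler_pM2l ie0).
  have -> : e^-1 * (k * y `^ q + (q - 1) * (e * x `^ q)) =
    k * e^-1 * y `^ q + (q - 1) * x `^ q by field; rewrite gt_eqF.
  by apply: le_trans h; rewrite le_eqVlt; apply/orP; left; apply/eqP; ring.
have q0 : 0 < q by lra.
rewrite -(ler_pM2l q0); apply: le_trans h _.
have A0 : 0 <= e * x `^ q by rewrite mulr_ge0 ?powR_ge0 // ltW.
have B0 : 0 <= k * y `^ q by rewrite mulr_ge0 ?powR_ge0.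
by nra.
Qed.

Lemma powR_mulX2 q x : 0 <= x -> (x ^+ 2) `^ q = x `^ (2 * q).
Proof. by move=> x0; rewrite -powR_mulrn // -powRrM. Qed.

Lemma powR_young2 p e x y : 2 <= p -> 0 < e -> 0 <= x -> 0 <= y ->
  x `^ (p - 2) * y ^+ 2 <= e * x `^ p + e^-1 `^ (p / 2 - 1) * y `^ p.
Proof.
move=> p2 e0 x0 y0.
have := @powR_young (p / 2) e (x ^+ 2) (y ^+ 2).
rewrite !powR_mulX2 //.
have -> : 2 * (p / 2) = p by field.
have -> : 2 * (p / 2 - 1) = p - 2 by field.
by apply; rewrite ?sqr_ge0 //; lra.
Qed.

(** A mean value inequality for the power [q - 1]. The factor [b] on the left stands in for the
    derivative, which is unbounded near 0 when [q < 2]. *)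
Lemma powR_pred_diff q a b : 1 <= q -> 0 < b -> b <= a ->
  b * (a `^ (q - 1) - b `^ (q - 1)) <= q * a `^ (q - 1) * (a - b).
Proof.
move=> q1 b0 ba.
have a0 : 0 <= a by rewrite (le_trans (ltW b0)).
have h := powR_tangent q1 (ltW b0) a0.
have ha := powR_pred_mul q1 a0; have hb := powR_pred_mul q1 (ltW b0).
have hm : b * a `^ (q - 1) <= a `^ q.
  by rewrite -ha mulrC ler_wpM2l // powR_ge0.
rewrite mulrBr [b * b `^ _]mulrC hb.
rewrite mulrBr -[q * _ * a]mulrA ha.
by lra.
Qed.

(* For [b] comparable to [a] this avoids the second derivative of [x `^ q],
   which is singular at 0 when [1 < q < 2]. *)
Lemma powR_taylor2 q a b : 1 <= q -> 0 < a -> 7 / 16 * a <= b <= 2 * a ->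
  b `^ q <= a `^ q + q * a `^ (q - 1) * (b - a)
    + q ^+ 2 * 2 `^ (q - 1) * (16 / 7) * (a `^ (q - 1) / a) * (b - a) ^+ 2.
Proof.
move=> q1 a0 /andP[ab ba].
have b0 : 0 < b by lra.
have q0 : 0 <= q by lra.
have q10 : 0 <= q - 1 by lra.
have h := powR_tangent q1 (ltW a0) (ltW b0).
have hb := powR_pred_mul q1 (ltW b0).
set U := a `^ (q - 1); set V := b `^ (q - 1) in h hb *.
have U0 : 0 < U by rewrite powR_gt0.
have V0 : 0 < V by rewrite powR_gt0.
have P1 : 1 <= 2 `^ (q - 1) :> R.
  by rewrite -[X in X <= _](powRr0 2); apply: ler_powR => //; lra.
have hm : forall c, 0 <= c -> c <= 2 * a -> c `^ (q - 1) <= 2 `^ (q - 1) * U.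
  by move=> c c0 ca; rewrite /U -powRM ?(ltW a0) //; apply: ge0_lerpowR.
(* The supporting line at [b] leaves the remainder [q * (V - U) * (b - a)]. [powR_pred_diff] bounds
   it by a multiple of [(b - a) ^ 2] divided by the smaller of [a] and [b], which is at least
   [7 / 16 * a]. *)
have {}h : b `^ q <= a `^ q + q * V * (b - a) by rewrite -hb in h *; lra.
apply: le_trans h _; rewrite -[_ + q * U * _ + _]addrA lerD2l.
rewrite -lerBlDl -mulrBl -mulrBr.
set K := 2 `^ (q - 1) in P1 hm *.
have -> : q ^+ 2 * K * (16 / 7) * (U / a) * (b - a) ^+ 2 =
   q * ((q * (K * U)) * (b - a) ^+ 2 * (16 / 7) / a) by field; rewrite gt_eqF.
rewrite -mulrA ler_wpM2l // ler_pdivlMr //.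
have KU : U <= K * U by rewrite ler_peMl // ltW.
have [le_ab|lt_ba] := leP a b.
- have h1 : a * (V - U) <= q * V * (b - a) by apply: powR_pred_diff.
  have h2 : V <= K * U by apply: hm => //; lra.
  have h3 : a * (V - U) * (b - a) <= q * V * (b - a) * (b - a).
    by rewrite ler_wpM2r // subr_ge0.
  have h4 : q * V * (b - a) * (b - a) <= q * (K * U) * (b - a) ^+ 2.
    by rewrite -mulrA -expr2 ler_wpM2r ?sqr_ge0 // ler_wpM2l.
  have h5 : 0 <= q * (K * U) * (b - a) ^+ 2.
    by rewrite mulr_ge0 ?sqr_ge0 // mulr_ge0 // mulr_ge0 //; lra.
  by lra.
- have h1 : b * (U - V) <= q * U * (a - b).
    by apply: powR_pred_diff => //; exact: ltW.
  have h3 : b * (U - V) * (a - b) <= q * U * (a - b) * (a - b).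
    by rewrite ler_wpM2r // subr_ge0 ltW.
  have h4 : q * U * (a - b) * (a - b) <= q * (K * U) * (b - a) ^+ 2.
    rewrite -mulrA -expr2 -sqrrN opprB ler_wpM2r ?sqr_ge0 //.
    by rewrite ler_wpM2l.
  have VU : V <= U by apply: ge0_lerpowR => //; exact: ltW.
  have h6 : 0 <= (U - V) * (a - b) by rewrite mulr_ge0 // subr_ge0 // ltW.
  have h7 : 7 / 16 * a * ((U - V) * (a - b)) <= b * (U - V) * (a - b).
    by rewrite -[b * _ * _]mulrA ler_wpM2r.
  by lra.
Qed.

(** The first bracket serves [4 * w <= a]: [81 / 7] is [16 / 7] from [powR_taylor2] times
    [(9 / 4) ^ 2] from [|n ^ 2 - a ^ 2| <= 9 / 4 * (a * w)], and [p] covers the [w ^ 2] in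
    [n ^ 2 - a ^ 2]. The second serves [a < 4 * w], where [n <= 5 * w] and
    [a ^ (p - 1) * w <= 4 ^ (p - 1) * w ^ p]. *)
Definition pnorm_const p : R :=
  ((p / 2) ^+ 2 * 2 `^ (p / 2 - 1) * (81 / 7) + p)
    + (5 `^ p + p * 4 `^ (p - 1)).

Lemma pnorm_const_ge0 p : 2 <= p -> 0 <= pnorm_const p.
Proof.
move=> p2; rewrite /pnorm_const !addr_ge0 ?mulr_ge0 ?powR_ge0 ?sqr_ge0 //; lra.
Qed.

(* [a], [w], [n], [s] stand for |y|, |u|, |y + u| and <y, u>. *)
Lemma pnorm_expansion p a w n s : 2 <= p -> 0 <= a -> 0 <= w -> 0 <= n ->
  n ^+ 2 = a ^+ 2 + 2 * s + w ^+ 2 -> `|s| <= a * w ->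
  n `^ p <= a `^ p + p * a `^ (p - 2) * s
    + pnorm_const p * (a `^ (p - 2) * w ^+ 2 + w `^ p).
Proof.
move=> p2 a0 w0 n0 nE; rewrite ler_norml => /andP[s1 s2].
have P0 : 0 <= (p / 2) ^+ 2 * 2 `^ (p / 2 - 1) * (81 / 7).
  by rewrite !mulr_ge0 ?powR_ge0 ?sqr_ge0 //; lra.
have Q0 : 0 <= 5 `^ p + p * 4 `^ (p - 1).
  by rewrite addr_ge0 ?mulr_ge0 ?powR_ge0 //; lra.
have A0 : 0 <= a `^ (p - 2) * w ^+ 2 by rewrite mulr_ge0 ?powR_ge0 ?sqr_ge0.
have W0 : 0 <= w `^ p by rewrite powR_ge0.
have p0 : 0 <= p by lra.
(* For a small perturbation, [|n ^ 2 - a ^ 2| <= 9 / 16 * a ^ 2] keeps [n ^ 2] in the window of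
   [powR_taylor2], applied to squares with exponent [p / 2]. For a large one, every term is
   dominated by a multiple of [w ^ p]. *)
have [wa|aw] := leP (4 * w) a.
- have [a00|an0] := eqVneq a 0.
    have w00 : w = 0 by lra.
    have -> : s = 0 by move: s1 s2; rewrite a00 mul0r; lra.
    have -> : n = 0.
      by move: nE; rewrite a00 w00; nra.
    rewrite powR0; last by lra.
    rewrite mulr0 addr0 addr_ge0 ?powR_ge0 // mulr_ge0 ?pnorm_const_ge0 //.
    exact: addr_ge0.
  have {an0}a0 : 0 < a by rewrite lt_neqAle eq_sym an0.
  have := @powR_taylor2 (p / 2) (a ^+ 2) (n ^+ 2).
  rewrite !powR_mulX2 ?(ltW a0) //.
  have -> : 2 * (p / 2) = p by field.
  have -> : 2 * (p / 2 - 1) = p - 2 by field.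
  set U := a `^ (p - 2) in A0 *.
  have U0 : 0 < U by rewrite powR_gt0.
  have aw0 : 0 <= a * w by rewrite mulr_ge0 // ltW.
  have aw2 : 4 * (a * w) <= a ^+ 2.
    by rewrite mulrCA expr2 ler_wpM2l // ltW.
  have ww2 : 4 * w ^+ 2 <= a * w by rewrite expr2 mulrA ler_wpM2r.
  have w20 : 0 <= w ^+ 2 by rewrite sqr_ge0.
  move=> /(_ ltac:(lra)) /(_ ltac:(by rewrite exprn_gt0)) /(_ ltac:(lra)).
  move=> h; apply: le_trans h _.
  have tE : n ^+ 2 - a ^+ 2 = 2 * s + w ^+ 2 by lra.
  rewrite tE.
  have t2 : (2 * s + w ^+ 2) ^+ 2 <= 81 / 16 * (a ^+ 2 * w ^+ 2).
    have h1 : 2 * s + w ^+ 2 <= 9 / 4 * (a * w) by lra.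
    have h2 : - (9 / 4 * (a * w)) <= 2 * s + w ^+ 2 by lra.
    have -> : 81 / 16 * (a ^+ 2 * w ^+ 2) = (9 / 4 * (a * w)) ^+ 2 by field.
    by nra.
  have hU : (p / 2) ^+ 2 * 2 `^ (p / 2 - 1) * (16 / 7) * (U / a ^+ 2) *
       (2 * s + w ^+ 2) ^+ 2 <=
     (p / 2) ^+ 2 * 2 `^ (p / 2 - 1) * (81 / 7) * (U * w ^+ 2).
    have -> : (p / 2) ^+ 2 * 2 `^ (p / 2 - 1) * (81 / 7) * (U * w ^+ 2) =
      (p / 2) ^+ 2 * 2 `^ (p / 2 - 1) * (16 / 7) * (U / a ^+ 2) *
         (81 / 16 * (a ^+ 2 * w ^+ 2)) by field; rewrite gt_eqF.
    apply: ler_wpM2l => //.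
    rewrite mulr_ge0 ?divr_ge0 ?sqr_ge0 ?(ltW U0) //.
    by rewrite !mulr_ge0 ?powR_ge0 ?sqr_ge0.
  rewrite /pnorm_const.
  set H := (p / 2) ^+ 2 * 2 `^ (p / 2 - 1) * (81 / 7) in P0 hU *.
  set Q := 5 `^ p + _ in Q0 *.
  have : 0 <= p * (U * w ^+ 2) by rewrite mulr_ge0.
  have : 0 <= Q * (U * w ^+ 2) by rewrite mulr_ge0.
  set X := _ * (_ + _) ^+ 2 in hU *. clearbody H Q X.
  have : 0 <= (H + p + Q) * w `^ p by rewrite mulr_ge0 // !addr_ge0.
  by lra.
- have nw : n <= 5 * w by nra.
  have h1 : n `^ p <= 5 `^ p * w `^ p by rewrite -powRM //; apply: ge0_lerpowR.
  have h2 : a `^ (p - 2) * (- s) <= 4 `^ (p - 1) * w `^ p.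
    apply: (@le_trans _ _ (a `^ (p - 1) * w)).
      have [a00|an0] := eqVneq a 0.
        have -> : s = 0 by move: s1 s2; rewrite a00 mul0r; lra.
        by rewrite oppr0 mulr0 mulr_ge0 ?powR_ge0.
      have -> : p - 1 = (p - 1 - 1) + 1 by ring.
      rewrite (@powRD _ a (p - 1 - 1) 1) ?an0 ?implybT // powRr1 //.
      have -> : p - 1 - 1 = p - 2 by ring.
      by rewrite -mulrA ler_wpM2l ?powR_ge0 //; lra.
    rewrite -(@powR_pred_mul p w) //; last by lra.
    rewrite mulrA ler_wpM2r // -powRM //; apply: ge0_lerpowR => //; lra.
  have h3 : p * (a `^ (p - 2) * (- s)) <= p * (4 `^ (p - 1) * w `^ p).
    by rewrite ler_wpM2l.
  have h4 : 0 <= a `^ p by rewrite powR_ge0.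
  rewrite /pnorm_const.
  set H := _ * _ * _ + p.
  have H0 : 0 <= H by rewrite /H addr_ge0.
  have h5 : 0 <= (H + (5 `^ p + p * 4 `^ (p - 1))) * (a `^ (p - 2) * w ^+ 2).
    by rewrite mulr_ge0 // addr_ge0.
  have h6 : 0 <= H * w `^ p by rewrite mulr_ge0.
  by lra.
Qed.

(* If [m] is the running maximum of a nonnegative submartingale [s], this is a
   supermartingale (a multiple of minus the Azema-Yor process), which yields
   Doob's inequality in L^p. *)
Definition azema_yor p m s : R := (p - 1) * m `^ p - p * m `^ (p - 1) * s.

(** When [x] becomes the new maximum, the left side is [- x ^ p] and the claim is the supporting
    line of the power [p] at [y]. *)
Lemma azema_yor_step p x y : 1 <= p -> 0 <= x -> 0 <= y ->
  azema_yor p (Num.max y x) x <= azema_yor p y x.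
Proof.
move=> p1 x0 y0; rewrite /azema_yor; case: (leP y x) => // yx.
rewrite -mulrA powR_pred_mul //.
by have := powR_tangent p1 x0 y0; lra.
Qed.

End PowerInequalities.

(** * Scalar products *)

Section ScalarProduct.
Set Implicit Arguments.
Unset Strict Implicit.
Variables (R : realType) (d : nat) (ip : {dot 'rV[R]_d for idfun}).
Implicit Types x y z : 'rV[R]_d.
Local Notation N := (ipnorm ip).

Lemma ipC x y : ip x y = ip y x.
Proof. by rewrite hermC /= expr0 mul1r. Qed.

Lemma ipDl x y z : ip (x + y) z = ip x z + ip y z.
Proof. exact: linearDl. Qed.

Lemma ipDr x y z : ip x (y + z) = ip x y + ip x z.
Proof. exact: linearDr. Qed.

Lemma ipZl a x z : ip (a *: x) z = a * ip x z.
Proof. exact: linearZl_LR. Qed.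

Lemma ipZr a x z : ip x (a *: z) = a * ip x z.
Proof. exact: linearZr_LR. Qed.

Lemma ip0r x : ip x 0 = 0.
Proof. exact: linear0r. Qed.

Lemma ip_gt0 x : x != 0 -> 0 < ip x x.
Proof. exact: neq0_dnorm_gt0. Qed.

Lemma ip_ge0 x : 0 <= ip x x.
Proof.
have [->|/ip_gt0/ltW //] := eqVneq x 0.
by rewrite ip0r.
Qed.

Lemma ipnorm_ge0 x : 0 <= N x.
Proof. exact: sqrtr_ge0. Qed.

Lemma sqr_ipnorm x : N x ^+ 2 = ip x x.
Proof. by rewrite sqr_sqrtr // ip_ge0. Qed.

Lemma ip_cauchy x y : `|ip x y| <= N x * N y.
Proof.
rewrite -ler_sqr ?nnegrE ?mulr_ge0 ?ipnorm_ge0 // real_normK ?num_real //.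
rewrite exprMn !sqr_ipnorm.
have [->|y0] := eqVneq y 0; first by rewrite !ip0r expr0n mulr0.
have yy := ip_gt0 y0.
have := ip_ge0 (ip y y *: x + (- ip x y) *: y).
rewrite !(ipDl, ipDr, ipZl, ipZr) (ipC y x).
rewrite [X in 0 <= X](_ : _ = ip y y * (ip x x * ip y y - ip x y ^+ 2)); last by ring.
by rewrite pmulr_rge0 // subr_ge0.
Qed.

Lemma sqr_ipnormD x y :
  N (x + y) ^+ 2 = N x ^+ 2 + 2 * ip x y + N y ^+ 2.
Proof. by rewrite !sqr_ipnorm ipDl !ipDr (ipC y x); ring. Qed.

Lemma ipnormD x y : N (x + y) <= N x + N y.
Proof.
rewrite -ler_sqr ?nnegrE ?addr_ge0 ?ipnorm_ge0 // sqr_ipnormD sqrrD.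
have := le_trans (ler_norm _) (ip_cauchy x y).
by rewrite -mulr_natr; lra.
Qed.

Lemma ipnormZ a x : N (a *: x) = `|a| * N x.
Proof. by rewrite /ipnorm ipZl ipZr mulrA sqrtrM ?sqr_ge0 // -expr2 sqrtr_sqr. Qed.

(* At [x = 0] the quotient is the junk value 0. *)
Lemma ipnorm_subgrad x y : ip x y / N x + N x <= N (x + y).
Proof.
have [->|x0] := eqVneq x 0.
  by rewrite ipC ip0r mul0r add0r add0r /ipnorm ip0r sqrtr0 sqrtr_ge0.
have nx : 0 < N x by rewrite sqrtr_gt0 ip_gt0.
rewrite -(ler_pM2r nx) mulrDl divfK ?gt_eqF // -expr2 sqr_ipnorm addrC -ipDr.
by rewrite mulrC (le_trans (ler_norm _)) // ip_cauchy.
Qed.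

Lemma ip_expand x y : ip x y = \sum_i y ord0 i * ip x (delta_mx ord0 i).
Proof.
rewrite {1}(row_sum_delta y) linear_sumr; apply: eq_bigr => i _.
exact: ipZr.
Qed.

(** Riesz representation by the inverse Gram matrix. The Gram matrix is invertible because a vector
    in its left kernel is orthogonal to every basis vector, hence to itself. *)
Lemma coord_riesz : exists r : 'I_d -> 'rV[R]_d,
  forall i x, x ord0 i = ip (r i) x.
Proof.
pose M : 'M[R]_d := \matrix_(i, j) ip (delta_mx ord0 i) (delta_mx ord0 j).
have ME v j : (v *m M) ord0 j = ip v (delta_mx ord0 j).
  rewrite ipC ip_expand mxE; apply: eq_bigr => i _.
  by rewrite mxE ipC.
have Mu : M \in unitmx.
  rewrite -row_free_unit; apply: inj_row_free => v vM.
  apply/eqP; apply/negPn/negP => /ip_gt0.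
  rewrite ip_expand big1 ?ltxx // => i _.
  by rewrite -ME vM mxE mulr0.
exists (fun i => delta_mx ord0 i *m invmx M) => i x.
rewrite ip_expand (bigD1 i) //= big1 => [|j ji].
  by rewrite -ME mulmxKV // mxE !eqxx mulr1 addr0.
by rewrite -ME mulmxKV // mxE (negbTE ji) andbF mulr0.
Qed.

Lemma coord_le_ipnorm : exists C : R, 0 <= C /\
  forall i x, `|x ord0 i| <= C * N x.
Proof.
have [r rE] := coord_riesz.
exists (\sum_i N (r i)); split; first by apply: sumr_ge0 => i _; exact: ipnorm_ge0.
move=> i x; rewrite rE (le_trans (ip_cauchy _ _)) // ler_wpM2r ?ipnorm_ge0 //.
by rewrite (bigD1 i) //= lerDl sumr_ge0 // => j _; exact: ipnorm_ge0.
Qed.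

End ScalarProduct.

(** * Measurability and martingale differences *)

Section SubSigmaAlgebra.
Set Implicit Arguments.
Unset Strict Implicit.
Variables (R : realType) (disp : measure_display) (T : measurableType disp).
Variables (d : nat) (G : set (set T)).
Hypothesis sG : sigma_algebra [set: T] G.
Local Notation gT := (g_sigma_algebraType G).

(** [gT] is [T] with [G] as canonical sigma-algebra, so that measurability with respect to one
    member of a filtration becomes an instance of [measurable_fun]. *)
Lemma sub_measurableE : (measurable : set (set gT)) = G.
Proof. exact: (@measurable_g_measurableTypeE T G sG). Qed.

Lemma sub_measurable_set (A : set gT) : measurable A -> G A.
Proof. by rewrite sub_measurableE. Qed.

Lemma vec_measurable_coord (X : T -> 'rV[R]_d) (i : 'I_d) :
  vec_measurable G X -> measurable_fun [set: gT] (fun w : gT => X w ord0 i).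
Proof.
move=> mX; apply: (measurability _ (RGenOpens.measurableE R)) => //.
move=> _ [_ [a [b ->] <-]]; rewrite setTI.
rewrite [X in X _]sub_measurableE.
apply: (mX ((fun x : 'rV[R]_d => x ord0 i) @^-1` `]a, b[%classic)).
apply: sub_sigma_algebra => /=.
by apply: open_comp => [x _|]; [exact: coord_continuous|exact: interval_open].
Qed.

(** Second countability: [U] is the union of those open cubes with rational centre and radius
    [1 / (n + 1)] that it contains, and each cube is cut out by finitely many coordinate conditions.
    A radius below [e / 2] suffices, as a cube around a centre near [X w] then stays in the ball of
    radius [e]. *)
Lemma open_rV_preimage (X : T -> 'rV[R]_d) (U : set 'rV[R]_d) :
  (forall i, measurable_fun [set: gT] (fun w : gT => X w ord0 i)) ->
  open U -> G (X @^-1` U).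
Proof.
move=> mX oU.
pose B (k : 'rV[rat]_d * nat) : set 'rV[R]_d :=
  [set x | forall i, `|ratr (k.1 ord0 i) - x ord0 i| < k.2.+1%:R^-1].
pose S (k : 'rV[rat]_d * nat) : set gT :=
  if `[< B k `<=` U >] then X @^-1` (B k) else set0.
have -> : X @^-1` U = \bigcup_k S k.
  apply/seteqP; split => w /=; last first.
    by move=> [k _]; rewrite /S; case: asboolP => // + ?; apply.
  move=> Uw; have /nbhs_ballP[e /= e0 eU] := open_nbhs_nbhs (conj oU Uw).
  have [n hn] : exists n : nat, n.+1%:R^-1 < e / 2.
    have [n _ hn] := near_infty_natSinv_lt (PosNum (divr_gt0 e0 (ltr0Sn R 1))).
    by exists n; exact: (hn n (leqnn n)).
  have /choice[q hq] : forall i, exists q : rat,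
      `|ratr q - X w ord0 i| < n.+1%:R^-1.
    move=> i.
    have [|q] := @rat_in_itvoo R (X w ord0 i - n.+1%:R^-1) (X w ord0 i + n.+1%:R^-1).
      by rewrite ltrBlDr -addrA ltrDl addr_gt0.
    by rewrite in_itv /= -ltr_distl => ?; exists q.
  exists (\row_i q i, n) => //; rewrite /S; case: asboolP => [_|].
    by move=> i; rewrite /= mxE.
  case => x Bx; apply: eU; split => // i j; rewrite ord1.
  rewrite -ball_normE /=.
  have := Bx j; rewrite /= mxE => h1; have h2 := hq j.
  rewrite (_ : _ - _ = (X w ord0 j - ratr (q j)) + (ratr (q j) - x ord0 j)); last by ring.
  rewrite (le_lt_trans (ler_normD _ _)) // distrC.
  by rewrite [X in _ < X]splitr ltrD // (lt_trans _ hn).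
suff : (measurable : set (set gT)) (\bigcup_k S k) by rewrite sub_measurableE.
apply: countable_bigcupT_measurable => // k; rewrite /S.
case: asboolP => // _.
rewrite [X in _ X](_ : _ = \bigcap_(i in [set: 'I_d])
    ((fun w : gT => `|ratr (k.1 ord0 i) - X w ord0 i|) @^-1` `]-oo, k.2.+1%:R^-1[%classic)).
  apply: fin_bigcap_measurable => // i _.
  rewrite -[X in _ X]setTI.
  have mf : measurable_fun [set: gT] (fun w : gT => `|ratr (k.1 ord0 i) - X w ord0 i|).
    apply: measurableT_comp => //; apply: measurable_funB => //.
  by apply: mf => //; exact: measurable_itv.
apply/seteqP; split => w /=.
  by move=> h i _ /=; rewrite in_itv /=; exact: h.
by move=> h i; have := h i I; rewrite /= in_itv.
Qed.

(** The sets whose preimage lies in [G] form a sigma-algebra, so the open sets decide. *)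
Lemma coord_vec_measurable (X : T -> 'rV[R]_d) :
  (forall i, measurable_fun [set: gT] (fun w : gT => X w ord0 i)) ->
  vec_measurable G X.
Proof.
move=> mX C mC.
have := sigma_algebra_image X sG; move/smallest_sub => /(_ [set U | open U]).
rewrite /image_set_system => h.
have /h : [set U : set 'rV[R]_d | open U] `<=` [set B | G ([set: T] `&` X @^-1` B)].
  by move=> U oU /=; rewrite setTI; exact: open_rV_preimage.
by move=> /(_ _ mC) /=; rewrite setTI.
Qed.

Lemma measurable_ip (ip : {dot 'rV[R]_d for idfun}) (X Y : T -> 'rV[R]_d) :
  (forall i, measurable_fun [set: gT] (fun w : gT => X w ord0 i)) ->
  (forall i, measurable_fun [set: gT] (fun w : gT => Y w ord0 i)) ->
  measurable_fun [set: gT] (fun w : gT => ip (X w) (Y w)).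
Proof.
move=> mX mY.
under eq_fun do rewrite ip_expand.
apply: measurable_sum => i; apply: measurable_funM => //.
under eq_fun do rewrite ipC ip_expand.
by apply: measurable_sum => j; apply: measurable_funM.
Qed.

Lemma measurable_sqrt : measurable_fun [set: R] (@Num.sqrt R).
Proof.
by apply: continuous_measurable_fun; exact: sqrt_continuous.
Qed.

Lemma measurable_ipnorm (ip : {dot 'rV[R]_d for idfun}) (X : T -> 'rV[R]_d) :
  (forall i, measurable_fun [set: gT] (fun w : gT => X w ord0 i)) ->
  measurable_fun [set: gT] (fun w : gT => ipnorm ip (X w)).
Proof.
move=> mX; apply: (measurableT_comp measurable_sqrt).
exact: measurable_ip.
Qed.

Lemma sub_measurable_fun (f : T -> R) : G `<=` measurable ->
  measurable_fun [set: gT] (f : gT -> R) -> measurable_fun [set: T] f.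
Proof.
move=> Gm mf _ B mB; apply: Gm; rewrite -[X in X _]sub_measurableE.
exact: mf.
Qed.

End SubSigmaAlgebra.

Section RealIntegrable.
Set Implicit Arguments.
Unset Strict Implicit.
Variables (R : realType) (disp : measure_display) (T : measurableType disp).
Variable P : probability T R.
Local Notation "'integ' f" := (P.-integrable [set: T] (EFin \o f)) (at level 10).
Implicit Types f g : T -> R.

Lemma integ_measurable f : integ f -> measurable_fun [set: T] f.
Proof. by move=> /measurable_int /measurable_EFinP. Qed.

Lemma eq_integ f g : f =1 g -> integ f -> integ g.
Proof. by move=> /funext ->. Qed.

Lemma integZl k f : integ f -> integ (fun w => k * f w).
Proof.
move=> i; rewrite /comp; under eq_fun do rewrite EFinM; exact: integrableZl.
Qed.

Lemma integD f g : integ f -> integ g -> integ (fun w => f w + g w).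
Proof.
move=> i j; rewrite /comp; under eq_fun do rewrite EFinD; exact: integrableD.
Qed.

Lemma integ_cst (k : R) : integ (fun=> k).
Proof. exact: finite_measure_integrable_cst. Qed.

Lemma integ_sum (I : Type) (s : seq I) (h : I -> T -> R) :
  (forall i, integ (h i)) -> integ (fun w => \sum_(i <- s) h i w).
Proof.
move=> ih; rewrite /comp; under eq_fun do rewrite -sumEFin.
by apply: integrable_sum => // i _; exact: ih.
Qed.

Lemma Rintegral_sum (I : Type) (s : seq I) (h : I -> T -> R) :
  (forall i, integ (h i)) ->
  \int[P]_w (\sum_(i <- s) h i w) = \sum_(i <- s) \int[P]_w h i w.
Proof.
move=> ih; elim: s => [|i s IH].
  under eq_Rintegral do rewrite big_nil.
  by rewrite big_nil Rintegral_cst // mul0r.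
under eq_Rintegral do rewrite big_cons.
by rewrite big_cons RintegralD ?IH //; exact: integ_sum.
Qed.

Lemma le_integ f g : measurable_fun [set: T] f -> (forall w, `|f w| <= g w) ->
  integ g -> integ f.
Proof.
move=> mf fg; apply: le_integrable => //; first exact/measurable_EFinP.
by move=> w _ /=; rewrite lee_fin (le_trans (fg w)) // ler_norm.
Qed.

End RealIntegrable.

(** * Pulling a [G]-measurable factor out of a conditionally centred variable *)

Section ConditionallyCentered.
Set Implicit Arguments.
Unset Strict Implicit.
Variables (R : realType) (disp : measure_display) (T : measurableType disp).
Variables (P : probability T R) (G : set (set T)).
Hypotheses (sG : sigma_algebra [set: T] G) (Gm : G `<=` measurable).
Import HBNNSimple.
Local Notation gT := (g_sigma_algebraType G).
Local Notation "'integ' f" := (P.-integrable [set: T] (EFin \o f)) (at level 10).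

Variable Z : T -> R.
Hypotheses (iZ : integ Z)
  (Z0 : forall A, G A -> (\int[P]_(w in A) (Z w)%:E = 0)%E).

(** The level sets of a simple [g] lie in [G], so the integral is a finite combination of integrals
    of [Z] over sets of [G]. *)
Lemma integral_nnsfun_mul0 (g : {nnsfun gT >-> R}) :
  integ (fun w => g w * Z w) /\ (\int[P]_w (g w * Z w)%:E = 0)%E.
Proof.
have mA y : G (g @^-1` [set y]).
  by apply: (sub_measurable_set sG); exact: measurable_sfunP.
have iA y : integ (fun w => \1_(g @^-1` [set y]) w * Z w).
  apply: (le_integrable _ _ _ iZ) => //.
    apply/measurable_EFinP; apply: measurable_funM.
      by apply: measurable_indic; apply: Gm; exact: mA.
    by apply/measurable_EFinP; exact: measurable_int iZ.
  move=> w _ /=; rewrite lee_fin normrM indicE.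
  by case: (w \in _); rewrite ?normr1 ?mul1r // normr0 mul0r.
have iyA y := integZl y (iA y).
set s : seq R := finmap.enum_fset (fset_set (g @` setT)); set n := size s.
have E w : (g w * Z w)%:E = (\sum_(i < n) (s`_i * (\1_(g @^-1` [set s`_i]) w * Z w))%:E)%E.
  rewrite (fimfunEord g) sumEFin mulr_suml; congr EFin.
  by apply: eq_bigr => i _; rewrite mulrA.
split.
  rewrite /comp; under eq_fun do rewrite E.
  by apply: integrable_sum => // i _; exact: iyA.
under eq_integral do rewrite E.
rewrite integral_sum //; last by move=> i; exact: iyA.
rewrite big1 // => i _.
under eq_integral do rewrite EFinM.
rewrite integralZl //; last exact: iA.
have -> : (\int[P]_w (\1_(g @^-1` [set s`_i]) w * Z w)%:E =
    \int[P]_(w in g @^-1` [set s`_i]) (Z w)%:E)%E.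
  rewrite [RHS]integral_mkcond; apply: eq_integral => w _.
  by rewrite epatch_indic /= muleC.
by rewrite Z0 ?mule0 //; exact: mA.
Qed.

(** Simple functions [g n] with [0 <= g n <= h] converge to [h], and [|h * Z|] dominates
    [g n * Z]. *)
Lemma integral_ge0_mul0 (h : T -> R) : (forall w, 0 <= h w) ->
  measurable_fun [set: gT] (h : gT -> R) -> integ (fun w => h w * Z w) ->
  (\int[P]_w (h w * Z w)%:E = 0)%E.
Proof.
move=> h0 mh ih.
have mh' : measurable_fun [set: gT] (EFin \o h : gT -> \bar R) by exact/measurable_EFinP.
pose g := nnsfun_approx measurableT mh'.
have h0' (w : gT) : [set: gT] w -> (0 <= (EFin \o h) w)%E by rewrite lee_fin.
have cg w : g n w @[n --> \oo] --> h w.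
  exact: (fine_cvg (cvg_nnsfun_approx measurableT mh' h0' (I : [set: gT] w))).
have gh n w : g n w <= h w.
  by rewrite -lee_fin /g nnsfun_approxE; exact: (le_approx n h0').
have := @dominated_cvg _ T R P setT measurableT
  (fun n w => (g n w * Z w)%:E) (fun w => (h w * Z w)%:E) (fun w => `|h w * Z w|%:E).
have c0 : (\int[P]_w (g n w * Z w)%:E)%E @[n --> \oo] --> (0 : \bar R).
  rewrite (_ : (fun n => _) = fun=> 0%E); first exact: cvg_cst.
  by apply/funext => n; have [] := integral_nnsfun_mul0 (g n).
move=> dc; apply/esym.
apply: (cvg_unique _ c0) => //; apply: dc => //.
- by move=> n; have [+ _] := integral_nnsfun_mul0 (g n); exact: measurable_int.
- by move=> w _; apply: cvg_EFin; [exact: nearW|apply: cvgMr_tmp; exact: cg].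
- exact: integrable_abse ih.
- move=> n w _; rewrite /= lee_fin !normrM ler_wpM2r //.
  by rewrite !ger0_norm.
Qed.

Lemma integral_mul0 (h : T -> R) :
  measurable_fun [set: gT] (h : gT -> R) -> integ (fun w => h w * Z w) ->
  (\int[P]_w (h w * Z w)%:E = 0)%E.
Proof.
move=> mh ih.
pose hp w := Num.max (h w) 0; pose hn w := Num.max (- h w) 0.
have hE w : h w = hp w - hn w.
  by rewrite /hp /hn; case: (leP (h w) 0); case: (leP (- h w) 0); lra.
have mhp : measurable_fun [set: gT] (hp : gT -> R) by exact: measurable_maxr.
have mhn : measurable_fun [set: gT] (hn : gT -> R).
  by apply: measurable_maxr => //; exact: measurableT_comp.
have mZ : measurable_fun [set: T] Z.
  by apply/measurable_EFinP; exact: measurable_int iZ.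
have ibd (k : T -> R) : measurable_fun [set: gT] (k : gT -> R) ->
    (forall w, `|k w| <= `|h w|) -> integ (fun w => k w * Z w).
  move=> mk kh; apply: (le_integrable _ _ _ ih) => //.
    by apply/measurable_EFinP; apply: measurable_funM => //; exact: (sub_measurable_fun sG).
  by move=> w _ /=; rewrite lee_fin !normrM ler_wpM2r.
have ip : integ (fun w => hp w * Z w).
  apply: ibd => // w; rewrite /hp; case: (leP (h w) 0) => //.
  by rewrite normr0.
have iN : integ (fun w => hn w * Z w).
  apply: ibd => // w; rewrite /hn; case: (leP (- h w) 0) => //; last by rewrite normrN.
  by rewrite normr0.
under eq_integral do rewrite hE mulrBl EFinB.
rewrite integralB //.
rewrite !integral_ge0_mul0 ?sube0 // => w.
- by rewrite /hn le_max lexx orbT.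
- by rewrite /hp le_max lexx orbT.
Qed.

End ConditionallyCentered.

Section MartingaleDifference.
Set Implicit Arguments.
Unset Strict Implicit.
Variables (R : realType) (disp : measure_display) (T : measurableType disp).
Variables (P : probability T R) (G : set (set T)).
Hypotheses (sG : sigma_algebra [set: T] G) (Gm : G `<=` measurable).
Local Notation gT := (g_sigma_algebraType G).
Local Notation "'integ' f" := (P.-integrable [set: T] (EFin \o f)) (at level 10).
Variables (d : nat) (ip : {dot 'rV[R]_d for idfun}).

(** The conditional expectation is given coordinatewise, so the scalar product is expanded in
    coordinates. Each term is integrable by Cauchy-Schwarz and the bound of coordinates by the
    norm. *)
Lemma cond_centered_ip (D Y : T -> 'rV[R]_d) :
  is_cond_expectation P G D (fun=> 0) ->
  (forall i, measurable_fun [set: gT] (fun w : gT => Y w ord0 i)) ->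
  integ (fun w => ipnorm ip (Y w) * ipnorm ip (D w)) ->
  integ (fun w => ip (Y w) (D w)) /\ (\int[P]_w (ip (Y w) (D w))%:E = 0)%E.
Proof.
move=> [iD _ _ D0] mY iYD.
have [C [C0 hC]] := coord_le_ipnorm ip.
pose h i w := ip (Y w) (delta_mx ord0 i).
have mh i : measurable_fun [set: gT] (h i : gT -> R).
  by apply: measurable_ip => // j; under eq_fun do rewrite mxE; exact: measurable_cst.
have mD i : measurable_fun [set: T] (fun w => D w ord0 i).
  by apply/measurable_EFinP; exact: measurable_int (iD i).
have iC k := integZl k iYD.
have ihD i : integ (fun w => h i w * D w ord0 i).
  apply: (le_integrable _ _ _ (iC (C * ipnorm ip (delta_mx ord0 i)))) => //.
    by apply/measurable_EFinP; apply: measurable_funM => //; exact: (sub_measurable_fun sG).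
  move=> w _ /=; rewrite lee_fin normrM.
  rewrite [X in _ <= X]ger0_norm ?mulr_ge0 ?ipnorm_ge0 //.
  rewrite (_ : C * _ * _ = (ipnorm ip (Y w) * ipnorm ip (delta_mx ord0 i)) *
    (C * ipnorm ip (D w))); last by ring.
  by apply: ler_pM => //; exact: ip_cauchy.
have E w : (ip (Y w) (D w))%:E = (\sum_(i < d) (h i w * D w ord0 i)%:E)%E.
  by rewrite ip_expand sumEFin; congr EFin; apply: eq_bigr => i _; rewrite mulrC.
split.
  rewrite /comp; under eq_fun do rewrite E.
  by apply: integrable_sum => // i _; exact: ihD.
under eq_integral do rewrite E.
rewrite integral_sum // big1 // => i _.
apply: (integral_mul0 sG Gm (iD i)) => // A GA.
rewrite -D0 //; apply: integral0_eq => w _; by rewrite mxE.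
Qed.

End MartingaleDifference.

(** * One-step estimates *)

Section OneStep.
Set Implicit Arguments.
Unset Strict Implicit.
Variable R : realType.

Lemma powR_addle (p x y : R) : 0 <= p -> 0 <= x -> 0 <= y ->
  (x + y) `^ p <= 2 `^ p * (x `^ p + y `^ p).
Proof.
move=> p0 x0 y0.
wlog xy : x y x0 y0 / x <= y.
  move=> h; have [xy|/ltW yx] := leP x y; first exact: h.
  by rewrite addrC [x `^ p + _]addrC; exact: h.
apply: (@le_trans _ _ (2 `^ p * y `^ p)); last first.
  by rewrite ler_wpM2l ?powR_ge0 // lerDr powR_ge0.
by rewrite -powRM //; apply: ge0_lerpowR; lra.
Qed.

Lemma powR_le1 (q x : R) : 0 <= q -> 0 <= x <= 1 -> x `^ q <= 1.
Proof. by move=> q0 /andP[x0 x1]; have := ge0_lerpowR q0 x0 x1; rewrite powR1. Qed.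

(* [s], [ny], [nx], [D] stand for |x_(n-1)|, |y|, |x_n|, |D_n| and [k] for
   <y, u>, where [x_n = y + u] and [u = sqrt (g) * v *: D_n]. *)
Lemma moment_step (p b C : R) : 2 <= p -> 0 < b -> 0 <= C ->
  exists2 K : R, 0 <= K & forall g l s v D ny nx k : R,
    0 < g <= 1 -> g * b <= 1 -> 0 <= l <= 1 -> 0 <= s -> 0 <= v -> 0 <= D ->
    0 <= ny -> 0 <= nx ->
    ny <= l * ((1 - g * b) * s + g * (C * v)) ->
    nx ^+ 2 = ny ^+ 2 + 2 * k + (Num.sqrt g * v * D) ^+ 2 ->
    `|k| <= ny * (Num.sqrt g * v * D) ->
    nx `^ p <= (1 - g * (b / 2)) * (l * s) `^ p
      + g * (K * (v `^ p * (1 + D `^ p))) + p * ny `^ (p - 2) * k.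
Proof.
move=> p2 b0 C0.
have p1 : 1 <= p by lra.
have p0 : 0 <= p by lra.
set Q := pnorm_const p; have Q0 : 0 <= Q := pnorm_const_ge0 p2.
(* The Young weight is chosen so that the mixed term costs at most half of the contraction rate [b];
   the other half survives as [b / 2]. *)
pose e := b / 2 / (Q + 1).
have e0 : 0 < e by rewrite !divr_gt0 //; lra.
have Qe : Q * e <= b / 2.
  rewrite /e mulrA ler_pdivrMr; last by lra.
  by rewrite mulrC ler_wpM2l //; lra.
set J := e^-1 `^ (p / 2 - 1); have J0 : 0 <= J by exact: powR_ge0.
(* Writing [g * (C * v)] as [g * b * (C / b * v)] turns the bound on [ny] into a convex combination
   of [l * s] and [C / b * v], so the power [p] preserves the rate. The 2 covers the factor
   [1 + g * (b / 2)]. *)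
pose U := 2 * (b * (C / b) `^ p).
have U0 : 0 <= U by rewrite mulr_ge0 // mulr_ge0 ?powR_ge0 // ltW.
exists (U + Q * J + Q) => [|g l s v D ny nx k].
  by rewrite addr_ge0 // addr_ge0 // mulr_ge0.
move=> /andP[g0 g1] gb /andP[l0 l1] s0 v0 D0 ny0 nx0 hny hnx hk.
have sg0 : 0 <= Num.sqrt g by exact: sqrtr_ge0.
have gb0 : 0 <= g * b by rewrite mulr_ge0 // ltW.
have vD0 : 0 <= v * D by rewrite mulr_ge0.
have w0 : 0 <= Num.sqrt g * v * D by rewrite !mulr_ge0.
have h := @pnorm_expansion R p ny _ nx k p2 ny0 w0 nx0 hnx hk.
apply: le_trans h _.
have w2 : (Num.sqrt g * v * D) ^+ 2 = g * (v * D) ^+ 2.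
  by rewrite -mulrA exprMn sqr_sqrtr // ltW.
have vDp : (v * D) `^ p = v `^ p * D `^ p by rewrite powRM.
have V0 : 0 <= v `^ p by exact: powR_ge0.
have X0 : 0 <= v `^ p * D `^ p by rewrite mulr_ge0 ?powR_ge0.
(* Here [g ^ (p / 2) <= g], from [g <= 1] and [p >= 2]. *)
have wp : (Num.sqrt g * v * D) `^ p <= g * (v `^ p * D `^ p).
  rewrite -mulrA powRM // -vDp ler_wpM2r ?powR_ge0 //.
  have -> : Num.sqrt g `^ p = (Num.sqrt g ^+ 2) `^ (p / 2).
    by rewrite powR_mulX2 //; congr (_ `^ _); field.
  rewrite sqr_sqrtr ?(ltW g0) //; apply: ge1r_powR; last by lra.
  by rewrite g0.
have h1 : ny `^ (p - 2) * (Num.sqrt g * v * D) ^+ 2 <=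
    g * (e * ny `^ p + J * (v `^ p * D `^ p)).
  rewrite w2 mulrCA ler_wpM2l ?(ltW g0) // -vDp.
  exact: powR_young2.
have hy : ny `^ p <= (1 - g * b) * (l * s) `^ p + g * b * ((C / b) `^ p * v `^ p).
  apply: (@le_trans _ _ (((1 - g * b) * (l * s) + g * b * (C / b * v)) `^ p)).
    apply: ge0_lerpowR => //; apply: le_trans hny _.
    rewrite mulrDr mulrCA lerD2l.
    have -> : g * b * (C / b * v) = g * (C * v) by field; rewrite gt_eqF.
    by rewrite ler_piMl // mulr_ge0 ?mulr_ge0 // ltW.
  rewrite -[(C / b) `^ p * _]powRM // ?divr_ge0 // ?(ltW b0) //.
  apply: powR_convex => //; first by rewrite gb0.
    exact: mulr_ge0.
  by rewrite mulr_ge0 // divr_ge0 // ltW.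
have S0 : 0 <= (l * s) `^ p by exact: powR_ge0.
set S := (l * s) `^ p in hy S0 *; set V := v `^ p in V0 X0 wp h1 hy *.
set X := V * D `^ p in X0 wp h1 *; set Y := ny `^ p in h1 hy *.
have Y0 : 0 <= Y by exact: powR_ge0.
set W := (C / b) `^ p in U hy U0 *.
have W0 : 0 <= W by exact: powR_ge0.
have -> : V * (1 + D `^ p) = V + X by rewrite /X; ring.
set H1 := ny `^ (p - 2) * _ ^+ 2 in h1 *.
have q1 : Q * (H1 + (Num.sqrt g * v * D) `^ p) <= Q * (g * (e * Y + J * X) + g * X).
  by rewrite ler_wpM2l // lerD.
have q2 : g * (Q * e * Y) <= g * (b / 2 * Y).
  by rewrite ler_wpM2l ?(ltW g0) // ler_wpM2r.
have q3 : (1 + g * (b / 2)) * Y <= (1 + g * (b / 2)) * ((1 - g * b) * S + g * b * (W * V)).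
  by rewrite ler_wpM2l //; lra.
have q4 : (1 + g * (b / 2)) * (1 - g * b) * S <= (1 - g * (b / 2)) * S.
  by rewrite ler_wpM2r //; nra.
have q5 : (1 + g * (b / 2)) * (g * b * (W * V)) <= 2 * (g * b * (W * V)).
  by rewrite ler_wpM2r ?mulr_ge0 ?(ltW g0) ?(ltW b0) //; lra.
have g0' := ltW g0.
have q6 : 0 <= g * (U * X) by apply: mulr_ge0 => //; exact: mulr_ge0.
have q7 : 0 <= g * ((Q * J + Q) * V).
  by apply: mulr_ge0 => //; apply: mulr_ge0 => //; apply: addr_ge0 => //; exact: mulr_ge0.
have UE : g * (U * V) = 2 * (g * b * (W * V)) by rewrite /U; ring.
set Kp := p * _ * k.
have -> : g * ((U + Q * J + Q) * (V + X)) =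
  g * (U * V) + g * (U * X) + g * ((Q * J + Q) * V) + g * (Q * J + Q) * X by ring.
clearbody Kp U W V X Y S H1; rewrite -/Q; clearbody Q J e; lra.
Qed.

Lemma azema_yor_le (p m s : R) : 0 <= p -> 0 <= s ->
  azema_yor p m s <= (p - 1) * m `^ p.
Proof. by move=> p0 s0; rewrite /azema_yor gerBl !mulr_ge0 ?powR_ge0. Qed.

(** The discount rate satisfies [(p - 1) * a = (p - 1) * A + p * C]. The part [p * C] pays for the
    drift loss [p * m ^ (p - 1) * g * C * (s + v)] through Young's inequality, and [A] remains as
    the contraction rate of the Azema-Yor expression; [h] is the martingale increment. *)
Lemma running_max_step (p C A g m s v s' h : R) :
  2 <= p -> 0 <= C -> 0 <= A ->
  let a := A + p * C / (p - 1) in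
  0 <= g -> a * g <= 1 -> 0 <= m -> 0 <= s -> 0 <= v -> 0 <= s' ->
  s - g * (C * (s + v)) + h <= s' ->
  azema_yor p (Num.max ((1 - a * g) * m) s') s' <=
    (1 - a * g) `^ (p - 1) * ((1 - A * g) * azema_yor p m s)
    + g * (p * C * 2 `^ p * (s `^ p + v `^ p))
    - p * ((1 - a * g) * m) `^ (p - 1) * h.
Proof.
move=> p2 C0 A0 a g0 ag m0 s0 v0 s'0 hs.
have p1 : 1 <= p by lra.
have p0 : 0 <= p by lra.
have p10 : 0 <= p - 1 by lra.
have a0 : 0 <= a by rewrite addr_ge0 // divr_ge0 // mulr_ge0.
have l0 : 0 <= 1 - a * g by lra.
have l1 : 1 - a * g <= 1 by rewrite gerBl mulr_ge0.
set m' := (1 - a * g) * m; have m'0 : 0 <= m' by rewrite mulr_ge0.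
apply: (le_trans (azema_yor_step p1 s'0 m'0)).
rewrite [X in X <= _]/azema_yor.
have k0 := powR_ge0 (1 - a * g) (p - 1).
have k1 : (1 - a * g) `^ (p - 1) <= 1 by apply: powR_le1; rewrite ?l0.
have -> : m' `^ p = (1 - a * g) `^ (p - 1) * ((1 - a * g) * m `^ p).
  by rewrite /m' powRM // -(@powR_pred_mul _ p (1 - a * g)) //; ring.
have m'E : m' `^ (p - 1) = (1 - a * g) `^ (p - 1) * m `^ (p - 1).
  by rewrite /m' powRM.
have hm : m' `^ (p - 1) * (s - g * (C * (s + v)) + h) <= m' `^ (p - 1) * s'.
  by rewrite ler_wpM2l ?powR_ge0.
have {}hm : p * (m' `^ (p - 1) * (s - g * (C * (s + v)) + h)) <= p * (m' `^ (p - 1) * s').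
  by rewrite ler_wpM2l.
rewrite m'E in hm *.
set k := (1 - a * g) `^ (p - 1) in k0 k1 hm *.
have := @powR_young R p 1 m (s + v) p1 ltr01 m0 (addr_ge0 s0 v0).
rewrite invr1 powR1 !mul1r => hy.
have hsv := powR_addle p0 s0 v0.
have hb := azema_yor_le m p0 s0.
rewrite /azema_yor in hb *.
have M0 := powR_ge0 m p.
set M := m `^ p in hy hb M0 *; set N := m `^ (p - 1) in hm hy hb *.
set Z := s `^ p + v `^ p in hsv *.
have hE : (p - 1) * a = (p - 1) * A + p * C by rewrite /a; field; lra.
set a1 := a in hE k hm k0 k1 *.
have Cy : g * (p * C * (N * (s + v))) <= g * (p * C * (M + 2 `^ p * Z)).
  rewrite ler_wpM2l // ler_wpM2l ?mulr_ge0 //; lra.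
(* The Azema-Yor expression may be negative, so only its upper bound [(p - 1) * M] is used. *)
have AB : g * (A * ((p - 1) * M - p * N * s)) <= g * (A * ((p - 1) * M)).
  by rewrite ler_wpM2l // ler_wpM2l.
have hgE : (p - 1) * a1 * g * M = (p - 1) * A * g * M + p * C * g * M.
  by rewrite hE; ring.
have key : (p - 1) * ((1 - a1 * g) * M) - p * N * s + g * (p * C * (N * (s + v)))
    <= (1 - A * g) * ((p - 1) * M - p * N * s) + g * (p * C * 2 `^ p * Z).
  by lra.
have kk : k * ((p - 1) * ((1 - a1 * g) * M) - p * N * s + g * (p * C * (N * (s + v))))
    <= k * ((1 - A * g) * ((p - 1) * M - p * N * s)) + g * (p * C * 2 `^ p * Z).
  apply: (@le_trans _ _ (k * ((1 - A * g) * ((p - 1) * M - p * N * s) + g * (p * C * 2 `^ p * Z)))).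
    by rewrite ler_wpM2l.
  rewrite mulrDr lerD2l ler_piMl //.
  by rewrite mulr_ge0 // !mulr_ge0 ?powR_ge0 // addr_ge0 ?powR_ge0.
by lra.
Qed.

(** Young's inequality with weight [1 / (2 * p)] bounds the subtracted term by half of [m ^ p] plus
    a multiple of [s ^ p]; since [p - 1 >= 1], at least half of [m ^ p] is left. *)
Lemma azema_yor_control (p m s : R) : 2 <= p -> 0 <= m -> 0 <= s ->
  m `^ p <= 2 * azema_yor p m s + 2 * (p * (2 * p) `^ (p - 1)) * s `^ p.
Proof.
move=> p2 m0 s0.
have e0 : 0 < (2 * p)^-1 by rewrite invr_gt0; lra.
have := @powR_young R p _ m s (ltac:(lra)) e0 m0 s0.
rewrite invrK /azema_yor => h.
have {}h : p * (m `^ (p - 1) * s) <= p * ((2 * p)^-1 * m `^ p + (2 * p) `^ (p - 1) * s `^ p).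
  by rewrite ler_wpM2l //; lra.
have hE : p * ((2 * p)^-1 * m `^ p) = m `^ p / 2 by field; lra.
rewrite mulrDr hE in h.
have M0 := powR_ge0 m p.
have : 0 <= (p - 2) * m `^ p by rewrite mulr_ge0 // subr_ge0.
by lra.
Qed.

(** Bernoulli's inequality for [(y / x) ^ (1 + d)] with [y = x + 1], multiplied by [x / y / y ^ d]:
    a discrete integral comparison. *)
Lemma series_powR_step (d : R) (j : nat) : 0 < d -> (0 < j)%N ->
  d * j.+1%:R `^ (- (1 + d)) <= j%:R `^ (- d) - j.+1%:R `^ (- d).
Proof.
move=> d0 j0.
have x0 : 0 < j%:R :> R by rewrite ltr0n.
have y0 : 0 < j.+1%:R :> R by rewrite ltr0n.
have yE : j.+1%:R = j%:R + 1 :> R by rewrite -natr1.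
set x := j%:R in x0 yE *; set y := j.+1%:R in y0 yE *.
have := @powR_tangent R (1 + d) (y / x) 1 (ltac:(lra)) (ltac:(by rewrite divr_ge0 // ltW)) ler01.
rewrite !powR1 !mulr1.
have yy : y `^ (1 + d) = y * y `^ d by rewrite powRD ?powRr1 ?(ltW y0) ?(gt_eqF y0) ?implybT.
have -> : (y / x) `^ (1 + d) = y / x * (y `^ d * x `^ (- d)).
  rewrite powRM ?invr_ge0 ?(ltW x0) ?(ltW y0) // yy.
  rewrite -powR_inv1 ?(ltW x0) // -powRrM mulN1r opprD powRD ?(gt_eqF x0) ?implybT //.
  by rewrite powR_inv1 ?(ltW x0) //; ring.
rewrite !powRN yy.
have Y0 : 0 < y `^ d by rewrite powR_gt0.
have X0 : 0 < x `^ d by rewrite powR_gt0.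
set Y := y `^ d in Y0 *; set X := x `^ d in X0 *.
move=> h; rewrite -subr_ge0.
rewrite (_ : _ - _ = x / y / Y * (y / x * (Y * X^-1) + (1 + d - 1) - (1 + d) * (y / x))).
  by rewrite mulr_ge0 ?subr_ge0 // !divr_ge0 // ltW.
rewrite yE; field.
by rewrite !gt_eqF // -?yE.
Qed.

Lemma sum_powR_le (d : R) (k N : nat) : 0 < d -> (0 < k)%N -> (k <= N)%N ->
  \sum_(k <= j < N) j.+1%:R `^ (- (1 + d)) <= d^-1 * k%:R `^ (- d).
Proof.
move=> d0 k0 kN; rewrite ler_pdivlMl // mulr_sumr.
apply: (@le_trans _ _ (k%:R `^ (- d) - N%:R `^ (- d))); last by rewrite gerBl powR_ge0.
rewrite -[X in _ <= X]opprB -(telescope_sumr (fun j => j%:R `^ (- d))) // -sumrN.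
rewrite big_nat [X in _ <= X]big_nat; apply: ler_sum => j /andP[kj _].
by rewrite opprB; apply: series_powR_step => //; exact: leq_trans kj.
Qed.

(* Telescoping replaces a decomposition into blocks of indices on which the
   step sizes [g] add up to about 1. *)
Lemma weighted_sup_le (c : R) (g rho G : nat -> R) (k0 N k : nat) :
  0 <= c -> (forall n, 0 <= rho n <= rho n.+1) -> (forall n, 0 <= G n) ->
  (forall n, (k0 <= n)%N -> 0 <= g n.+1) ->
  (forall n, (k0 <= n)%N -> (1 - c * g n.+1) * G n <= G n.+1) ->
  (k0 <= k <= N)%N ->
  rho k * G k <= rho N * G N + c * \sum_(k0 <= j < N) rho j.+1 * g j.+1 * G j.
Proof.
move=> c0 hr G0 g0 hG /andP[k0k].
have r0 n : 0 <= rho n by have /andP[] := hr n.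
elim: N => [|N IH].
  rewrite leqn0 => /eqP k00; move: k0k; rewrite k00 leqn0 => /eqP ->.
  by rewrite big_geq // mulr0 addr0.
rewrite leq_eqVlt => /predU1P[<-|].
  rewrite lerDl mulr_ge0 // big_nat sumr_ge0 // => j /andP[kj _].
  by rewrite !mulr_ge0 // g0.
rewrite ltnS => kN; apply: (le_trans (IH kN)).
have k0N := leq_trans k0k kN.
rewrite big_nat_recr //= mulrDr [X in _ <= X]addrA [X in _ <= X]addrAC lerD2r.
apply: (@le_trans _ _ (rho N.+1 * G N)).
  by rewrite ler_wpM2r //; have /andP[] := hr N.
have := ler_wpM2l (r0 N.+1) (hG N k0N).
by lra.
Qed.

End OneStep.

(** * The dynamical system *)

Section AlmostEverywhere.
Set Implicit Arguments.
Unset Strict Implicit.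
Variables (R : realType) (disp : measure_display) (T : measurableType disp).
Variable P : probability T R.
Local Notation "'integ' f" := (P.-integrable [set: T] (EFin \o f)) (at level 10).
Implicit Types f g : T -> R.

Lemma ae_le_integ f g : measurable_fun [set: T] f ->
  {ae P, forall w, `|f w| <= g w} -> integ g -> integ f.
Proof.
move=> mf fg /integrableP[mg ig]; apply/integrableP; split.
  exact/measurable_EFinP.
apply: le_lt_trans ig; apply: ae_ge0_le_integral => //.
- by apply: measurableT_comp => //; exact/measurable_EFinP.
- by apply: measurableT_comp.
by apply: filterS fg => w fg _ /=; rewrite lee_fin (le_trans fg) // ler_norm.
Qed.

Lemma ae_le_Rintegral f g : integ f -> integ g ->
  {ae P, forall w, f w <= g w} -> \int[P]_w f w <= \int[P]_w g w.
Proof.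
move=> hf hg fg.
have mf := integ_measurable hf; have mg := integ_measurable hg.
have ih : integ (fun w => g w - f w).
  by apply: integD => //; apply: (eq_integ _ (integZl (-1) hf)) => w; rewrite mulN1r.
rewrite -subr_ge0 -RintegralB // fine_ge0 //.
rewrite (@ae_eq_integral _ _ _ P setT (fun w => (Num.max (g w - f w) 0)%:E)) //.
- by apply: integral_ge0 => w _; rewrite lee_fin le_max lexx orbT.
- exact: (measurable_int _ ih).
- by apply/measurable_EFinP; apply: measurable_maxr => //; exact: measurable_funB.
- apply: filterS fg => w fg _ /=; congr EFin.
  by rewrite max_l // subr_ge0.
Qed.

Lemma EFin_Rintegral f : integ f ->
  ((\int[P]_w f w)%:E = \int[P]_w (f w)%:E)%E.
Proof. by move=> hf; rewrite fineK //; exact: integrable_fin_num. Qed.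

Lemma integ_powR_add (p : R) f g : 0 <= p ->
  (forall w, 0 <= f w) -> (forall w, 0 <= g w) ->
  integ (fun w => f w `^ p) -> integ (fun w => g w `^ p) ->
  measurable_fun [set: T] f -> measurable_fun [set: T] g ->
  integ (fun w => (f w + g w) `^ p).
Proof.
move=> p0 f0 g0 hf hg mf mg.
apply: (le_integ _ _ (integZl (2 `^ p) (integD hf hg))).
  by apply: (measurableT_comp (measurable_powR p)); exact: measurable_funD.
by move=> w; rewrite ger0_norm ?powR_ge0 // powR_addle.
Qed.

Lemma integ_powRZ (p k : R) f : 0 <= k -> (forall w, 0 <= f w) ->
  integ (fun w => f w `^ p) -> integ (fun w => (k * f w) `^ p).
Proof.
move=> k0 f0 hf; apply: (eq_integ _ (integZl (k `^ p) hf)) => w.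
by rewrite powRM.
Qed.

Lemma integ_powR_mul (p : R) f g : 1 <= p ->
  (forall w, 0 <= f w) -> (forall w, 0 <= g w) ->
  integ (fun w => f w `^ p) -> integ (fun w => g w `^ p) ->
  measurable_fun [set: T] f -> measurable_fun [set: T] g ->
  integ (fun w => f w `^ (p - 1) * g w).
Proof.
move=> p1 f0 g0 hf hg mf mg.
apply: (le_integ _ _ (integD hf hg)).
  by apply: measurable_funM => //; exact: (measurableT_comp (measurable_powR _)).
move=> w; rewrite ger0_norm ?mulr_ge0 ?powR_ge0 //.
by have := @powR_young R p 1 _ _ p1 ltr01 (f0 w) (g0 w); rewrite invr1 powR1 !mul1r.
Qed.

End AlmostEverywhere.

Section DynamicalSystem.
Set Implicit Arguments.
Unset Strict Implicit.
Variables (R : realType) (p : R).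
Hypothesis hp : 2 <= p.
Variables (disp : measure_display) (T : measurableType disp) (P : probability T R).
Variable F : nat -> set (set T).
Hypothesis hF : is_filtration F.
Variables (d : nat) (ip : {dot 'rV[R]_d for idfun}).
Variable f : 'rV[R]_d -> 'rV[R]_d.
Hypothesis hf : vec_measurable (@borel_rV R d) f.
Variables (thetas : 'rV[R]_d) (gamma eps sigma : nat -> R).
Hypotheses (hgamma : forall n, (0 < n)%N -> 0 < gamma n)
  (heps : forall n, (0 < n)%N -> 0 <= eps n)
  (hsigma : forall n, (0 < n)%N -> 0 <= sigma n).
Variables (Rb D : nat -> T -> 'rV[R]_d).
Hypotheses (hRb : previsible F Rb) (hD : martingale_differences P F D).
Variables (theta0 : 'rV[R]_d) (theta : nat -> T -> 'rV[R]_d).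
Hypothesis htheta : is_dynamical_system f gamma eps sigma Rb D theta0 theta.
Variable v : nat -> R.
Hypothesis hv : forall n, v n = Num.sqrt (gamma n) * sigma n.
Variables (L L' : R).
Hypotheses (hL : 0 < L) (hL' : 0 < L')
  (ha1 : forall x : 'rV[R]_d, ip (x - thetas) (f x) <= - L * ipnorm ip (x - thetas) ^+ 2)
  (ha2 : forall x : 'rV[R]_d, ip (x - thetas) (f x) <= - L' * ipnorm ip (f x) ^+ 2).
Variables (CR M : R).
Hypotheses (CR0 : 0 <= CR) (M0 : 0 <= M)
  (hCR : forall n, (0 < n)%N -> {ae P, forall w, ipnorm ip (Rb n w) <= CR})
  (hM : forall n, (0 < n)%N -> (\int[P]_w (ipnorm ip (D n w) `^ p)%:E <= M%:E)%E).

Let p0 : 0 <= p := le_trans (ler0n R 2) hp.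

Local Notation N := (ipnorm ip).
Local Notation "'integ' f" := (P.-integrable [set: T] (EFin \o f)) (at level 10).
Local Notation gT n := (g_sigma_algebraType (F n)).
Local Notation x n w := (theta n w - thetas).
(** The [F n]-measurable part of [x n.+1], indexed by the time at which it is known. *)
Local Notation y n w :=
  (x n w + gamma n.+1 *: (f (theta n w) + eps n.+1 *: Rb n.+1 w)).

Lemma sub_filtration_measurable m n (h : T -> R) : (m <= n)%N ->
  measurable_fun [set: gT m] (h : gT m -> R) -> measurable_fun [set: gT n] (h : gT n -> R).
Proof.
move=> mn mh _ B mB; rewrite setTI.
have sF k := filtration_sigma_algebra hF k.
have h1 : F m (h @^-1` B).
  by apply: (sub_measurable_set (sF m)); rewrite -[X in measurable X]setTI; exact: mh.
have := filtration_nondecreasing hF mn h1.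
move: (sub_measurableE (sF n)) => /(congr1 (fun S : set (set T) => S (h @^-1` B))).
by move=> <-.
Qed.

Lemma filtration_measurable_fun n (h : T -> R) :
  measurable_fun [set: gT n] (h : gT n -> R) -> measurable_fun [set: T] h.
Proof.
apply: (sub_measurable_fun (filtration_sigma_algebra hF n)).
exact: (filtration_measurable hF).
Qed.

Lemma D_coord_measurable n i :
  measurable_fun [set: gT n.+1] (fun w : gT n.+1 => D n.+1 w ord0 i).
Proof.
apply: vec_measurable_coord; first exact: (filtration_sigma_algebra hF _).
by have [] := hD (ltn0Sn n).
Qed.

Lemma Rb_coord_measurable n i :
  measurable_fun [set: gT n] (fun w : gT n => Rb n.+1 w ord0 i).
Proof.
apply: vec_measurable_coord; first exact: (filtration_sigma_algebra hF _).
exact: (hRb (ltn0Sn n)).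
Qed.

Lemma theta_step n w : x n.+1 w = y n w + (gamma n.+1 * sigma n.+1) *: D n.+1 w.
Proof.
rewrite (dynamical_system_step htheta (ltn0Sn n)) /=.
rewrite [gamma n.+1 *: (_ + sigma n.+1 *: _)]scalerDr scalerA addrA.
rewrite [LHS]addrAC; congr (_ + _). exact: addrAC.
Qed.

Lemma f_coord_measurable n i :
  (forall i, measurable_fun [set: gT n] (fun w : gT n => theta n w ord0 i)) ->
  measurable_fun [set: gT n] (fun w : gT n => f (theta n w) ord0 i).
Proof.
move=> mtheta; have sF := filtration_sigma_algebra hF n.
have mf : vec_measurable (F n) (f \o theta n).
  by move=> B mB; exact: (coord_vec_measurable sF mtheta (hf mB)).
exact: (vec_measurable_coord sF i mf).
Qed.

(** Adaptedness by induction along the recursion: [Rb n.+1] is already [F n]-measurable, and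
    [D n.+1] enters only at time [n.+1]. *)
Lemma theta_coord_measurable n i :
  measurable_fun [set: gT n] (fun w : gT n => theta n w ord0 i).
Proof.
elim: n i => [|n IH] i.
  under eq_fun do rewrite (dynamical_system_init htheta).
  exact: measurable_cst.
under eq_fun do rewrite (dynamical_system_step htheta (ltn0Sn n)) !mxE /=.
have up := @sub_filtration_measurable n n.+1 _ (leqnSn n).
apply: measurable_funD; first exact: (up _ (IH i)).
apply: measurable_funM => //; apply: measurable_funD.
  apply: measurable_funD; first exact: (up _ (f_coord_measurable i IH)).
  by apply: measurable_funM => //; exact: (up _ (Rb_coord_measurable i)).
by apply: measurable_funM => //; exact: D_coord_measurable.
Qed.

Lemma x_coord_measurable n i :
  measurable_fun [set: gT n] (fun w : gT n => (x n w) ord0 i).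
Proof.
under eq_fun do rewrite !mxE.
by apply: measurable_funB => //; exact: theta_coord_measurable.
Qed.

Lemma y_coord_measurable n i :
  measurable_fun [set: gT n] (fun w : gT n => (y n w) ord0 i).
Proof.
under eq_fun do rewrite mxE [X in _ + X]mxE [X in _ * X]mxE.
apply: measurable_funD; first exact: x_coord_measurable.
apply: measurable_funM => //; apply: measurable_funD.
  exact: (f_coord_measurable i (@theta_coord_measurable n)).
by under eq_fun do rewrite mxE; apply: measurable_funM => //; exact: Rb_coord_measurable.
Qed.

Lemma x_norm_measurable n : measurable_fun [set: gT n] (fun w : gT n => N (x n w)).
Proof. by apply: measurable_ipnorm => i; exact: x_coord_measurable. Qed.

Lemma y_norm_measurable n : measurable_fun [set: gT n] (fun w : gT n => N (y n w)).
Proof. by apply: measurable_ipnorm => i; exact: y_coord_measurable. Qed.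

Lemma D_norm_measurable n : measurable_fun [set: T] (fun w => N (D n.+1 w)).
Proof.
apply: (@filtration_measurable_fun n.+1).
by apply: measurable_ipnorm => i; exact: D_coord_measurable.
Qed.

(** Condition (a) and Cauchy-Schwarz give [L' * |f z| ^ 2 <= |z - thetas| * |f z|]. *)
Lemma f_growth z : N (f z) <= L'^-1 * N (z - thetas).
Proof.
have [->|f0] := eqVneq (N (f z)) 0.
  by rewrite mulr_ge0 ?invr_ge0 ?ipnorm_ge0 // ltW.
have {}f0 : 0 < N (f z) by rewrite lt_neqAle eq_sym f0 ipnorm_ge0.
rewrite ler_pdivlMl // -(ler_pM2r f0).
have := ha2 z; have := ip_cauchy ip (z - thetas) (f z).
by rewrite ler_norml => /andP[+ _]; lra.
Qed.

Lemma y_growth n w : N (Rb n.+1 w) <= CR ->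
  N (y n w) <= (1 + gamma n.+1 / L') * N (x n w) + gamma n.+1 * eps n.+1 * CR.
Proof.
move=> hR; have g0 := hgamma (ltn0Sn n); have e0 := heps (ltn0Sn n).
have h1 := ipnormD ip (x n w) (gamma n.+1 *: (f (theta n w) + eps n.+1 *: Rb n.+1 w)).
have h2 := ipnormD ip (f (theta n w)) (eps n.+1 *: Rb n.+1 w).
rewrite !ipnormZ (gtr0_norm g0) in h1.
rewrite ipnormZ (ger0_norm e0) in h2.
apply: le_trans h1 _.
have h3 := f_growth (theta n w).
have h4 := ler_wpM2l e0 hR.
have : N (f (theta n w) + eps n.+1 *: Rb n.+1 w) <= L'^-1 * N (x n w) + eps n.+1 * CR by lra.
by move=> /(ler_wpM2l (ltW g0)); lra.
Qed.

Lemma integ_D n : integ (fun w => N (D n.+1 w) `^ p).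
Proof.
apply/integrableP; split.
  apply/measurable_EFinP; apply: (measurableT_comp (measurable_powR p)).
  exact: D_norm_measurable.
apply: le_lt_trans (ltry M); apply: le_trans (hM (ltn0Sn n)).
rewrite (eq_integral (fun w => (N (D n.+1 w) `^ p)%:E)) // => w _ /=.
by rewrite ger0_norm ?powR_ge0.
Qed.

Lemma Rintegral_D n : \int[P]_w (N (D n.+1 w) `^ p) <= M.
Proof. by rewrite -lee_fin EFin_Rintegral ?integ_D //; exact: hM. Qed.

Lemma integ_y n : integ (fun w => N (x n w) `^ p) -> integ (fun w => N (y n w) `^ p).
Proof.
move=> hx.
have mx := filtration_measurable_fun (@x_norm_measurable n).
have my := filtration_measurable_fun (@y_norm_measurable n).
have g0 := hgamma (ltn0Sn n); have e0 := heps (ltn0Sn n).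
set k := 1 + gamma n.+1 / L'; set c := gamma n.+1 * eps n.+1 * CR.
have k0 : 0 <= k by rewrite addr_ge0 // divr_ge0 // ltW.
have c0 : 0 <= c by rewrite !mulr_ge0 // ltW.
have x0 w : 0 <= N (x n w) by exact: ipnorm_ge0.
have hb : integ (fun w => (k * N (x n w) + c) `^ p).
  apply: (@integ_powR_add R disp T P p (fun w => k * N (x n w)) (fun=> c)) => //.
  - by move=> w; exact: mulr_ge0.
  - exact: integ_powRZ.
  - exact: integ_cst.
  - exact: measurable_funM.
apply: (ae_le_integ _ _ hb).
  exact: (measurableT_comp (measurable_powR p)).
apply: filterS (hCR (ltn0Sn n)) => w hR.
rewrite ger0_norm ?powR_ge0 //; apply: ge0_lerpowR => //; first exact: ipnorm_ge0.
exact: y_growth.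
Qed.

Lemma x_norm_step n w :
  N (x n.+1 w) <= N (y n w) + gamma n.+1 * sigma n.+1 * N (D n.+1 w).
Proof.
rewrite theta_step; apply: le_trans (ipnormD _ _ _) _.
rewrite ipnormZ ger0_norm // mulr_ge0 ?hsigma //.
by rewrite ltW // hgamma.
Qed.

(** Finiteness for each fixed [n], which makes the expectations in the recursions real numbers;
    uniform control comes later. *)
Lemma integ_x n : integ (fun w => N (x n w) `^ p).
Proof.
elim: n => [|n IH].
  rewrite /comp; under eq_fun do rewrite (dynamical_system_init htheta).
  exact: integ_cst.
have iy := integ_y IH.
have my := filtration_measurable_fun (@y_norm_measurable n).
have k0 : 0 <= gamma n.+1 * sigma n.+1 by rewrite mulr_ge0 ?hsigma // ltW // hgamma.
have hb : integ (fun w => (N (y n w) + gamma n.+1 * sigma n.+1 * N (D n.+1 w)) `^ p).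
  apply: (@integ_powR_add R disp T P p (fun w => N (y n w))
           (fun w => gamma n.+1 * sigma n.+1 * N (D n.+1 w))) => //.
  - by move=> w; exact: ipnorm_ge0.
  - by move=> w; rewrite mulr_ge0 // ipnorm_ge0.
  - exact: (integ_powRZ k0 (fun w => ipnorm_ge0 ip (D n.+1 w)) (integ_D n)).
  - by apply: measurable_funM => //; exact: D_norm_measurable.
apply: (le_integ _ _ hb).
  apply: (measurableT_comp (measurable_powR p)).
  exact: (filtration_measurable_fun (@x_norm_measurable n.+1)).
move=> w; rewrite ger0_norm ?powR_ge0 //; apply: ge0_lerpowR => //.
  exact: ipnorm_ge0.
exact: x_norm_step.
Qed.

(** By the second half of (a), the square of [|x + g f|] is at most [s ^ 2 + g (2 - g / L') <x, f>],
    and the first half makes this at most [(1 - g L1) ^ 2 s ^ 2] once [g L <= 2 L' (L - L1)]. The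
    factor [1 - g L2] is split off because [v] shrinks at most that fast; the 2 before [Ce]
    compensates it on the bias, as [1 - g L2 >= 1 / 2]. *)
Lemma y_contraction n w (L1 L2 Ce : R) : 0 <= L2 -> L2 < L1 -> L1 < L -> 0 <= Ce ->
  gamma n.+1 * L1 <= 1 -> gamma n.+1 * L2 <= 2^-1 ->
  gamma n.+1 * L <= 2 * L' * (L - L1) ->
  0 <= v n.+1 -> eps n.+1 <= Ce * v n.+1 -> N (Rb n.+1 w) <= CR ->
  N (y n w) <= (1 - gamma n.+1 * L2) *
    ((1 - gamma n.+1 * (L1 - L2)) * N (x n w) + gamma n.+1 * (2 * Ce * CR * v n.+1)).
Proof.
move=> L20 L21 L1L Ce0 gL1 gL2 gL v0 hev hR.
have g0 := hgamma (ltn0Sn n); have e0 := heps (ltn0Sn n).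
set g := gamma n.+1 in g0 gL1 gL2 gL *; set u := v n.+1 in v0 hev *.
set s := N (x n w); have s0 : 0 <= s by exact: ipnorm_ge0.
have -> : y n w = (x n w + g *: f (theta n w)) + (g * eps n.+1) *: Rb n.+1 w.
  by rewrite scalerDr scalerA addrA.
have h1 : N (x n w + g *: f (theta n w)) <= (1 - g * L1) * s.
  rewrite -ler_sqr ?nnegrE ?mulr_ge0 ?ipnorm_ge0 ?subr_ge0 //.
  rewrite sqr_ipnormD ipnormZ ipZr exprMn (gtr0_norm g0) exprMn -/s.
  have := ha1 (theta n w); have := ha2 (theta n w); rewrite -/s.
  set k := ip _ _; set q := N (f _) ^+ 2 => k2 k1.
  have gk : g * k <= - (g * L * s ^+ 2).
    by have := ler_wpM2l (ltW g0) k1; lra.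
  have gq : L' * (g ^+ 2 * q) <= - (g ^+ 2 * k).
    by have := ler_wpM2l (sqr_ge0 g) k2; lra.
  rewrite -(ler_pM2l hL').
  have gL'' : g <= 2 * L'.
    have := ler_wpM2l (ltW g0) (ltW L1L); have L10 : 0 < L1 by lra.
    have : 0 <= L' * L1 by rewrite mulr_ge0 // ltW.
    move=> ? ?; rewrite -(ler_pM2r hL); lra.
  have c0 : 0 <= 2 * L' - g by lra.
  have := ler_wpM2l c0 gk.
  have sL : 0 <= s ^+ 2 * g by rewrite mulr_ge0 ?sqr_ge0 // ltW.
  have := ler_wpM2l sL gL.
  have : 0 <= L' * (g * L1 * s) ^+ 2 by rewrite mulr_ge0 ?sqr_ge0 // ltW.
  by nra.
apply: le_trans (ipnormD _ _ _) _.
rewrite ipnormZ ger0_norm ?mulr_ge0 ?(ltW g0) //.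
have h2 : eps n.+1 * N (Rb n.+1 w) <= Ce * u * CR.
  by apply: ler_pM => //; exact: ipnorm_ge0.
have h3 := ler_wpM2l (ltW g0) h2.
have h4 : 0 <= g * (Ce * CR * u) by rewrite !mulr_ge0 // ltW.
have h5 : 0 <= (1 - 2 * (g * L2)) * (g * (Ce * CR * u)) by rewrite mulr_ge0 //; lra.
have h6 : 0 <= g * L2 * (g * (L1 - L2)) * s.
  by rewrite !mulr_ge0 // ?(ltW g0) // subr_ge0 ltW.
by lra.
Qed.

(** The norm enters the Azema-Yor expression with a negative coefficient, so a lower bound is
    wanted. The subgradient inequality keeps the noise linear, hence centred, and the drift costs at
    most its own norm. *)
Lemma x_norm_lower n w (Ce : R) : 0 <= Ce ->
  0 <= v n.+1 -> eps n.+1 <= Ce * v n.+1 -> N (Rb n.+1 w) <= CR ->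
  N (x n w) - gamma n.+1 * ((L'^-1 + Ce * CR) * (N (x n w) + v n.+1))
    + ip (x n w) ((gamma n.+1 * sigma n.+1) *: D n.+1 w) / N (x n w)
  <= N (x n.+1 w).
Proof.
move=> Ce0 v0 hev hR.
have g0 := hgamma (ltn0Sn n); have e0 := heps (ltn0Sn n).
set g := gamma n.+1 in g0 *; set u := v n.+1 in v0 hev *.
set s := N (x n w); have s0 : 0 <= s by exact: ipnorm_ge0.
set b := g *: (f (theta n w) + eps n.+1 *: Rb n.+1 w).
set c := (g * sigma n.+1) *: D n.+1 w.
have -> : x n.+1 w = x n w + (b + c) by rewrite theta_step addrA.
apply: le_trans (ipnorm_subgrad ip _ _).
rewrite -/s ipDr [X in _ <= X + _]mulrDl.
suff : - (g * ((L'^-1 + Ce * CR) * (s + u))) <= ip (x n w) b / s.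
  by set k1 := ip _ b / s; set k2 := ip _ c / s; clearbody k1 k2; lra.
have hb : N b <= g * ((L'^-1 + Ce * CR) * (s + u)).
  rewrite ipnormZ (gtr0_norm g0) ler_wpM2l ?(ltW g0) //.
  apply: le_trans (ipnormD _ _ _) _; rewrite ipnormZ (ger0_norm e0).
  have h2 : eps n.+1 * N (Rb n.+1 w) <= Ce * u * CR.
    by apply: ler_pM => //; exact: ipnorm_ge0.
  have h3 := f_growth (theta n w); rewrite -/s in h3.
  have h4 : 0 <= L'^-1 * u by rewrite mulr_ge0 // invr_ge0 ltW.
  have h5 : 0 <= Ce * CR * s by rewrite !mulr_ge0.
  by lra.
apply: (@le_trans _ _ (- N b)); first by rewrite lerN2.
have [s00|sn0] := eqVneq s 0.
  by rewrite s00 invr0 mulr0 oppr_le0 ipnorm_ge0.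
have {}s0 : 0 < s by rewrite lt_neqAle eq_sym sn0.
rewrite ler_pdivlMr // mulNr lerNl mulrC.
by have := ip_cauchy ip (x n w) b; rewrite ler_norml lerNl => /andP[].
Qed.

Lemma gamma_sigma n : gamma n.+1 * sigma n.+1 = Num.sqrt (gamma n.+1) * v n.+1.
Proof. by rewrite hv mulrA -expr2 sqr_sqrtr // ltW // hgamma. Qed.

(** The coefficient of [D n.+1] grows like the power [p - 1] of a variable in L^p, so its product
    with the L^p variable [|D|] is integrable. It serves the expansion of [|x|^p] with [q = |y|],
    and the running maximum with [q] its discounted value. *)
Lemma centered_term n (k q : T -> R) (z : T -> 'rV[R]_d) (C : R) :
  measurable_fun [set: gT n] (k : gT n -> R) ->
  (forall i, measurable_fun [set: gT n] (fun w : gT n => z w ord0 i)) ->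
  measurable_fun [set: T] q -> (forall w, 0 <= q w) -> integ (fun w => q w `^ p) ->
  (forall w, `|k w| * N (z w) <= C * q w `^ (p - 1)) ->
  integ (fun w => k w * ip (z w) (D n.+1 w)) /\
  \int[P]_w (k w * ip (z w) (D n.+1 w)) = 0.
Proof.
move=> mk mz mq q0 iq kz.
have sF := filtration_sigma_algebra hF n.
have mY i : measurable_fun [set: gT n] (fun w : gT n => (k w *: z w) ord0 i).
  by under eq_fun do rewrite mxE; exact: measurable_funM.
have mDn := D_norm_measurable n.
have iYD : integ (fun w => N (k w *: z w) * N (D n.+1 w)).
  have i1 : integ (fun w => q w `^ (p - 1) * N (D n.+1 w)).
    apply: (@integ_powR_mul R disp T P p q (fun w => N (D n.+1 w))) => //.
    - by move: hp; lra.
    - by move=> w; exact: ipnorm_ge0.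
    - exact: integ_D.
  apply: (le_integ _ _ (integZl C i1)).
    apply: measurable_funM => //.
    by apply: (@filtration_measurable_fun n); apply: measurable_ipnorm.
  move=> w; rewrite ger0_norm ?mulr_ge0 ?ipnorm_ge0 // ipnormZ mulrA.
  by rewrite ler_wpM2r ?ipnorm_ge0.
have [] := cond_centered_ip sF (@filtration_measurable _ _ _ hF n)
    ((hD (ltn0Sn n)).2) mY iYD.
have E w : ip (k w *: z w) (D n.+1 w) = k w * ip (z w) (D n.+1 w) by rewrite ipZl.
move=> i1 i2; split; first exact: (eq_integ E i1).
have -> : \int[P]_w (k w * ip (z w) (D n.+1 w)) = \int[P]_w (ip (k w *: z w) (D n.+1 w)).
  by apply: eq_Rintegral => w _; rewrite E.
by rewrite /Rintegral i2.
Qed.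

(** * Uniform bounds beyond an index [n1] from which all asymptotic conditions hold *)

Section Regime.
Variables (n1 : nat) (L1 L2 Ce : R).
Hypotheses (L20 : 0 < L2) (L21 : L2 < L1) (L1L : L1 < L) (Ce0 : 0 <= Ce).
(** The term [p * L2] offsets the decay of [v n ^ p], by Bernoulli; the extra 1 leaves a factor
    [1 - gamma] that absorbs the errors of size [gamma * v ^ p]. *)
Let A := 1 + p * L2.
Let C := L'^-1 + Ce * CR.
Let a := A + p * C / (p - 1).
Hypotheses
  (g1 : forall n, (n1 <= n)%N -> gamma n.+1 <= 1)
  (gL1 : forall n, (n1 <= n)%N -> gamma n.+1 * L1 <= 1)
  (gL2 : forall n, (n1 <= n)%N -> gamma n.+1 * L2 <= 2^-1)
  (gL : forall n, (n1 <= n)%N -> gamma n.+1 * L <= 2 * L' * (L - L1))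
  (ga : forall n, (n1 <= n)%N -> a * gamma n.+1 <= 1)
  (v0 : forall n, (n1 <= n)%N -> 0 < v n)
  (vdec : forall n, (n1 <= n)%N -> (1 - gamma n.+1 * L2) * v n <= v n.+1)
  (hev : forall n, (n1 <= n)%N -> eps n.+1 <= Ce * v n.+1).

Let p1 : 1 <= p.
Proof. by move: hp; lra. Qed.

Let C0 : 0 <= C.
Proof. by rewrite addr_ge0 ?mulr_ge0 // invr_ge0 ltW. Qed.

Let A0 : 0 <= A.
Proof. by rewrite addr_ge0 // mulr_ge0 // ltW. Qed.

Let a0 : 0 <= a.
Proof. by rewrite addr_ge0 // divr_ge0 ?mulr_ge0 // subr_ge0. Qed.

Lemma Rintegral_affine (f1 f2 f3 : T -> R) (k0 k1 k2 k3 : R) :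
  integ f1 -> integ f2 -> integ f3 ->
  integ (fun w => k0 + k1 * f1 w + k2 * f2 w + k3 * f3 w) /\
  \int[P]_w (k0 + k1 * f1 w + k2 * f2 w + k3 * f3 w) =
    k0 + k1 * (\int[P]_w f1 w) + k2 * (\int[P]_w f2 w) + k3 * (\int[P]_w f3 w).
Proof.
move=> i1 i2 i3; have j1 := integZl k1 i1; have j2 := integZl k2 i2.
have j3 := integZl k3 i3; have j0 := integ_cst P k0.
have j01 := integD j0 j1; have j012 := integD j01 j2.
split; first exact: integD.
rewrite !RintegralD // !RintegralZl //; congr (_ + _ + _ + _).
rewrite Rintegral_cst //; transitivity (k0 * fine 1%E); last exact: mulr1.
by congr (k0 * fine _); exact: probability_setT.
Qed.

Lemma v_powR_dec n : (n1 <= n)%N ->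
  (1 - gamma n.+1 * L2) `^ p * v n `^ p <= v n.+1 `^ p.
Proof.
move=> hn; have l0 : 0 <= 1 - gamma n.+1 * L2 by have := gL2 hn; lra.
have vn := ltW (v0 hn).
rewrite -powRM //; apply: ge0_lerpowR => //; [exact: mulr_ge0|exact: vdec].
Qed.

Lemma moment_bound : exists2 K : R, 0 <= K &
  forall n, (n1 <= n)%N -> \int[P]_w (N (x n w) `^ p) <= K * v n `^ p.
Proof.
have b0 : 0 < L1 - L2 by rewrite subr_gt0.
have Ey0 : 0 <= 2 * Ce * CR by rewrite !mulr_ge0.
have [Km Km0 hK] := moment_step hp b0 Ey0.
have vp n : (n1 <= n)%N -> 0 < v n `^ p by move=> hn; rewrite powR_gt0 // v0.
(* [K1] covers the starting index. [K2] balances the error [g * Km * (1 + M)] against the rate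
   [(L1 - L2) / 2], so [K1 + K2] is reproduced at each step. *)
pose K1 := (\int[P]_w (N (x n1 w) `^ p)) / v n1 `^ p.
pose K2 := Km * (1 + M) / ((L1 - L2) / 2).
have K10 : 0 <= K1.
  by rewrite divr_ge0 ?powR_ge0 // Rintegral_ge0 // => w _; exact: powR_ge0.
have b20 : 0 < (L1 - L2) / 2 by rewrite divr_gt0.
have K20 : 0 <= K2.
  by apply: divr_ge0; [rewrite mulr_ge0 // addr_ge0|exact: ltW].
exists (K1 + K2); first exact: addr_ge0.
elim=> [|n IH].
  rewrite leqn0 => /eqP n10; move: (vp n1 (leqnn _)); rewrite /K1 n10 => h.
  by rewrite mulrDl divfK ?gt_eqF // lerDl mulr_ge0 // ltW.
rewrite leq_eqVlt => /predU1P[<-|].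
  rewrite mulrDl divfK ?gt_eqF ?vp // lerDl mulr_ge0 //.
  exact: powR_ge0.
rewrite ltnS => hn; have {}IH := IH hn.
have g0 := hgamma (ltn0Sn n).
set g := gamma n.+1 in g0.
have gb : g * (L1 - L2) <= 1.
  by have := gL1 hn; have := mulr_ge0 (ltW g0) (ltW L20); rewrite -/g; lra.
have c0 : 0 <= g * sigma n.+1 by rewrite mulr_ge0 ?(ltW g0) // hsigma.
have my := @y_norm_measurable n.
pose k w := p * N (y n w) `^ (p - 2) * (g * sigma n.+1).
have [] := @centered_term n k (fun w => N (y n w)) (fun w => y n w) (p * (g * sigma n.+1)).
- apply: measurable_funM => //; apply: measurable_funM => //.
  exact: (measurableT_comp (measurable_powR _)).
- by move=> i; exact: y_coord_measurable.
- exact: filtration_measurable_fun my.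
- by move=> w; exact: ipnorm_ge0.
- exact: integ_y (integ_x n).
- move=> w; rewrite ger0_norm; last by rewrite /k mulr_ge0 // mulr_ge0 // powR_ge0.
  rewrite /k -(@powR_pred_mul _ (p - 1)) ?ipnorm_ge0 //; last by move: hp; lra.
  rewrite (_ : p - 1 - 1 = p - 2); last by ring.
  by rewrite le_eqVlt; apply/orP; left; apply/eqP; ring.
move=> ik k0.
have [ij] := Rintegral_affine (g * (Km * v n.+1 `^ p))
  ((1 - g * ((L1 - L2) / 2)) * (1 - g * L2) `^ p) (g * (Km * v n.+1 `^ p)) 1
  (integ_x n) (integ_D n) ik.
have hle : \int[P]_w (N (x n.+1 w) `^ p) <=
    \int[P]_w (g * (Km * v n.+1 `^ p)
     + (1 - g * ((L1 - L2) / 2)) * (1 - g * L2) `^ p * N (x n w) `^ p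
     + g * (Km * v n.+1 `^ p) * N (D n.+1 w) `^ p + 1 * (k w * ip (y n w) (D n.+1 w))).
  apply: ae_le_Rintegral => //; first exact: integ_x.
  apply: filterS (hCR (ltn0Sn n)) => w hR.
  have hn' : (n1 <= n.+1)%N := leqW hn.
  have hv0 := ltW (v0 hn').
  have := hK g (1 - g * L2) (N (x n w)) (v n.+1) (N (D n.+1 w)) (N (y n w)) (N (x n.+1 w))
    (ip (y n w) ((g * sigma n.+1) *: D n.+1 w)).
  have l0 : 0 <= 1 - g * L2 <= 1.
    by have := gL2 hn; have := mulr_ge0 (ltW g0) (ltW L20); rewrite -/g => ? ?; lra.
  have hsv : Num.sqrt g * v n.+1 * N (D n.+1 w) = N ((g * sigma n.+1) *: D n.+1 w).
    by rewrite ipnormZ ger0_norm // gamma_sigma.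
  rewrite hsv => /(_ ltac:(by rewrite g0 g1)) /(_ gb) /(_ l0) /(_ (ipnorm_ge0 _ _)).
  move=> /(_ hv0) /(_ (ipnorm_ge0 _ _)) /(_ (ipnorm_ge0 _ _)) /(_ (ipnorm_ge0 _ _)).
  have hy := y_contraction (ltW L20) L21 L1L Ce0 (gL1 hn) (gL2 hn) (gL hn) hv0
    (hev hn) hR.
  move=> /(_ hy).
  rewrite {1}theta_step sqr_ipnormD => /(_ erefl) /(_ (ip_cauchy _ _ _)).
  move=> h; apply: le_trans h _.
  rewrite powRM ?ipnorm_ge0 //; last by case/andP: l0.
  rewrite /k ipZr; set u1 := ip _ _; set u2 := N _ `^ (p - 2).
  by clearbody u1 u2; rewrite le_eqVlt; apply/orP; left; apply/eqP; ring.
move=> hI; apply: le_trans hle _; rewrite hI k0 mulr0 addr0.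
have hM' := Rintegral_D n.
have V0 := powR_ge0 (v n.+1) p.
have s1 : g * (Km * v n.+1 `^ p) * \int[P]_w (N (D n.+1 w) `^ p) <= g * (Km * v n.+1 `^ p) * M.
  by rewrite ler_wpM2l // !mulr_ge0 // ltW.
have e0 : 0 <= 1 - g * ((L1 - L2) / 2).
  by rewrite subr_ge0 mulrA ler_pdivrMr // mul1r (le_trans gb) // ler1n.
have s2 : (1 - g * L2) `^ p * \int[P]_w (N (x n w) `^ p) <= (K1 + K2) * v n.+1 `^ p.
  apply: (@le_trans _ _ ((K1 + K2) * ((1 - g * L2) `^ p * v n `^ p))).
    by rewrite mulrCA ler_wpM2l ?powR_ge0.
  by rewrite ler_wpM2l ?addr_ge0 // v_powR_dec.
have s5 := ler_wpM2l e0 s2.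
have s3 : g * ((L1 - L2) / 2) * (K2 * v n.+1 `^ p) = g * (Km * (1 + M) * v n.+1 `^ p).
  by rewrite /K2; field; rewrite subr_eq0 gt_eqF.
have s4 : 0 <= g * ((L1 - L2) / 2) * (K1 * v n.+1 `^ p).
  by apply: mulr_ge0; [apply: mulr_ge0; exact: ltW|exact: mulr_ge0].
set I1 := \int[P]_w (N (x n w) `^ p); set I2 := (\int[P]_w (N (D n.+1 w) `^ p)) in s1 *.
rewrite -mulrA -/I1; rewrite -/I1 in s5.
clear hI hM' ij ik k0 my hK IH; clearbody I1 I2 K1 K2 k; lra.
Qed.

(* The discount keeps E[(rmax n) `^ p] of order [v n `^ p] although [v] may
   decay exponentially in the sum of the step sizes. *)
Fixpoint rmax (n : nat) (w : T) : R :=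
  if n is k.+1 then
    if (n1 <= k)%N then
      Num.max ((1 - a * gamma k.+1) * rmax k w) (N (x k.+1 w))
    else N (x k.+1 w)
  else N (x 0%N w).

Lemma rmaxS n w : (n1 <= n)%N ->
  rmax n.+1 w = Num.max ((1 - a * gamma n.+1) * rmax n w) (N (x n.+1 w)).
Proof. by move=> /= ->. Qed.

Lemma rmax_start w : rmax n1 w = N (x n1 w).
Proof.
have : forall k, k = n1 -> rmax k w = N (x k w); last exact.
by case=> //= k kn; rewrite -kn ltnn.
Qed.

Lemma le_rmax n w : N (x n w) <= rmax n w.
Proof. by case: n => //= k; case: ifP => // _; rewrite le_max lexx orbT. Qed.

Lemma rmax_ge0 n w : 0 <= rmax n w.
Proof. exact: le_trans (ipnorm_ge0 _ _) (le_rmax n w). Qed.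

Lemma discount_ge0 n : (n1 <= n)%N -> 0 <= 1 - a * gamma n.+1 <= 1.
Proof.
move=> hn; rewrite subr_ge0 ga //= gerBl mulr_ge0 //.
by rewrite ltW // hgamma.
Qed.

Lemma rmax_measurable n : measurable_fun [set: gT n] (rmax n : gT n -> R).
Proof.
elim: n => [|n IH] /=; first exact: x_norm_measurable.
case: (n1 <= n)%N; last exact: x_norm_measurable.
apply: measurable_maxr; last exact: x_norm_measurable.
apply: measurable_funM => //.
exact: (sub_filtration_measurable (leqnSn n) IH).
Qed.

Lemma integ_rmax n : integ (fun w => rmax n w `^ p).
Proof.
elim: n => [|n IH] /=; first exact: integ_x.
case hn: (n1 <= n)%N; last exact: integ_x.
have /andP[l0 _] := discount_ge0 hn.
have i1 := integ_powRZ l0 (rmax_ge0 n) IH.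
apply: (le_integ _ _ (integD i1 (integ_x n.+1))).
  apply: (measurableT_comp (measurable_powR p)).
  have := filtration_measurable_fun (@rmax_measurable n.+1).
  by rewrite /= hn.
move=> w; rewrite ger0_norm ?powR_ge0 //.
by case: (leP ((1 - a * gamma n.+1) * rmax n w) (N (x n.+1 w))) => _;
  rewrite ?lerDl ?lerDr powR_ge0.
Qed.

Lemma integ_azema_yor n : integ (fun w => azema_yor p (rmax n w) (N (x n w))).
Proof.
have mr := filtration_measurable_fun (@rmax_measurable n).
have mx := filtration_measurable_fun (@x_norm_measurable n).
have i1 : integ (fun w => rmax n w `^ (p - 1) * N (x n w)).
  apply: (@integ_powR_mul R disp T P p (rmax n) (fun w => N (x n w))) => //.
  - exact: rmax_ge0.
  - by move=> w; exact: ipnorm_ge0.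
  - exact: integ_rmax.
  - exact: integ_x.
apply: (eq_integ _ (integD (integZl (p - 1) (integ_rmax n)) (integZl (- p) i1))).
by move=> w; rewrite /azema_yor; ring.
Qed.

(** At [n1] the maximum equals [|x|], so the expression is [- |x| ^ p] and the induction starts
    below 0. The constant solves [g * Q * (2 ^ p * Ks + 1) + (1 - g) * K = K]. *)
Lemma azema_yor_bound : exists2 K : R, 0 <= K & forall n, (n1 <= n)%N ->
  \int[P]_w (azema_yor p (rmax n w) (N (x n w))) <= K * v n `^ p.
Proof.
have [Ks Ks0 hKs] := moment_bound.
set Q := p * C * 2 `^ p.
have Q0 : 0 <= Q by rewrite /Q mulr_ge0 ?powR_ge0 // mulr_ge0.
exists (Q * (2 `^ p * Ks + 1)).
  by rewrite mulr_ge0 // addr_ge0 // mulr_ge0 // powR_ge0.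
set K := Q * _.
have K0 : 0 <= K by rewrite mulr_ge0 // addr_ge0 // mulr_ge0 // powR_ge0.
have start : \int[P]_w (azema_yor p (rmax n1 w) (N (x n1 w))) <= K * v n1 `^ p.
  apply: (@le_trans _ _ 0); last by rewrite mulr_ge0 ?powR_ge0.
  apply: (@le_trans _ _ (\int[P]_w (0 : R))); last by rewrite Rintegral_cst // mul0r.
  apply: le_Rintegral => //; [exact: integ_azema_yor|exact: integ_cst|].
  move=> w _; rewrite rmax_start /azema_yor -mulrA powR_pred_mul ?ipnorm_ge0 //.
  by have := powR_ge0 (N (x n1 w)) p; lra.
elim=> [|n IH]; first by rewrite leqn0 => /eqP n10; move: start; rewrite n10.
rewrite leq_eqVlt => /predU1P[<- //|]; rewrite ltnS => hn; have {}IH := IH hn.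
have g0 := hgamma (ltn0Sn n); set g := gamma n.+1 in g0.
have c0 : 0 <= g * sigma n.+1 by rewrite mulr_ge0 ?(ltW g0) // hsigma.
have /andP[l0 l1] := discount_ge0 hn; rewrite -/g in l0 l1.
have mr := @rmax_measurable n.
have mx := @x_norm_measurable n.
pose q w := (1 - a * g) * rmax n w.
have q0 w : 0 <= q w by rewrite mulr_ge0 // rmax_ge0.
pose k w := q w `^ (p - 1) * N (x n w) `^ (-1) * (g * sigma n.+1).
have mq : measurable_fun [set: gT n] (q : gT n -> R) by exact: measurable_funM.
have [] := @centered_term n k q (fun w => x n w) (g * sigma n.+1).
- apply: measurable_funM => //; apply: measurable_funM.
    exact: (measurableT_comp (measurable_powR _)).
  exact: (measurableT_comp (measurable_powR _)).
- by move=> i; exact: x_coord_measurable.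
- exact: filtration_measurable_fun mq.
- exact: q0.
- by apply: integ_powRZ => //; [exact: rmax_ge0|exact: integ_rmax].
- move=> w; rewrite ger0_norm; last first.
    by rewrite /k mulr_ge0 // mulr_ge0 ?powR_ge0.
  have [s0|s0] := eqVneq (N (x n w)) 0.
    by rewrite s0 mulr0 mulr_ge0 ?powR_ge0.
  by rewrite /k powR_inv1 ?ipnorm_ge0 // mulrAC divfK // mulrC.
move=> ik k0.
have /andP[kp0 kp1] : 0 <= (1 - a * g) `^ (p - 1) <= 1.
  by rewrite powR_ge0 powR_le1 ?l0 // subr_ge0.
set kp := (1 - a * g) `^ (p - 1) in kp0 kp1.
have [ij] := Rintegral_affine (g * (Q * v n.+1 `^ p)) (kp * (1 - A * g)) (g * Q) (- p)
   (integ_azema_yor n) (integ_x n) ik.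
have hle : \int[P]_w (azema_yor p (rmax n.+1 w) (N (x n.+1 w))) <=
   \int[P]_w (g * (Q * v n.+1 `^ p) + kp * (1 - A * g) * azema_yor p (rmax n w) (N (x n w))
     + g * Q * N (x n w) `^ p + - p * (k w * ip (x n w) (D n.+1 w))).
  apply: ae_le_Rintegral => //; first exact: integ_azema_yor.
  apply: filterS (hCR (ltn0Sn n)) => w hR.
  rewrite rmaxS //.
  have v1 := ltW (v0 (leqW hn)).
  have := x_norm_lower Ce0 v1 (hev hn) hR; rewrite -/g -/C => hx.
  have := running_max_step hp C0 A0 (ltW g0) (ga hn) (rmax_ge0 n w) (ipnorm_ge0 ip (x n w))
    v1 (ipnorm_ge0 ip (x n.+1 w)) hx.
  rewrite -/g -/a -/Q -/kp => h; apply: le_trans h _.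
  rewrite ipZr /k /q powR_inv1 ?ipnorm_ge0 //.
  set u1 := ip _ _; set u2 := (_ * rmax n w) `^ (p - 1).
  set u3 := (N (x n w))^-1; set u4 := azema_yor _ _ _.
  set u5 := N _ `^ p; set u6 := v n.+1 `^ p.
  clear hx ij ik k0 IH start mr mx mq hKs; clearbody u1 u2 u3 u4 u5 u6 kp Q.
  by rewrite le_eqVlt; apply/orP; left; apply/eqP; ring.
move=> hI; apply: le_trans hle _; rewrite hI k0 mulr0 addr0.
have V0 := powR_ge0 (v n.+1) p.
have Ag : 0 <= 1 - A * g.
  move: l0; rewrite !subr_ge0; apply: le_trans; rewrite ler_wpM2r ?(ltW g0) //.
  by rewrite lerDl divr_ge0 ?mulr_ge0 // subr_ge0.
have hvd := v_powR_dec hn; rewrite -/g in hvd.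
have vn0 := powR_ge0 (v n) p.
have ge1 := g1 hn; rewrite -/g in ge1.
(* Since [g * L2 <= 1 / 2], [v n] is at most twice [v n.+1]; this moves the moment bound to the next
   index. *)
have vhalf : v n `^ p <= 2 `^ p * v n.+1 `^ p.
  have := gL2 hn; rewrite -/g => hg2; have hd := vdec hn; rewrite -/g in hd.
  have v1 := ltW (v0 (leqW hn)); have v2 := ltW (v0 hn).
  by rewrite -powRM //; apply: ge0_lerpowR => //; nra.
have hIs : \int[P]_w (N (x n w) `^ p) <= Ks * (2 `^ p * v n.+1 `^ p).
  by apply: (le_trans (hKs n hn)); rewrite ler_wpM2l.
have dec : (1 - A * g) * v n `^ p <= (1 - g) * v n.+1 `^ p.
  have hB : 1 - p * (g * L2) <= (1 - g * L2) `^ p.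
    apply: powR_bernoulli => //; rewrite mulr_ge0 ?(ltW g0) ?(ltW L20) //=.
    by apply: le_trans (gL2 hn) _; rewrite invf_le1 // ler1n.
  apply: (@le_trans _ _ ((1 - g) * ((1 - g * L2) `^ p * v n `^ p))); last first.
    by rewrite ler_wpM2l // subr_ge0.
  rewrite mulrA ler_wpM2r //.
  apply: (@le_trans _ _ ((1 - g) * (1 - p * (g * L2)))); last first.
    by rewrite ler_wpM2l // subr_ge0.
  have : 0 <= g * (p * (g * L2)) by rewrite !mulr_ge0 // ltW.
  by rewrite /A; lra.
(* The integral may be negative, so [kp <= 1] is used only after replacing it by its nonnegative
   bound. *)
have hIa : kp * (1 - A * g) * \int[P]_w (azema_yor p (rmax n w) (N (x n w))) <=
    K * ((1 - g) * v n.+1 `^ p).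
  apply: (@le_trans _ _ (kp * (1 - A * g) * (K * v n `^ p))).
    by rewrite ler_wpM2l // mulr_ge0.
  apply: (@le_trans _ _ ((1 - A * g) * (K * v n `^ p))).
    by rewrite -mulrA ler_piMl // mulr_ge0 // mulr_ge0.
  by rewrite mulrCA ler_wpM2l.
have hIs' : g * Q * \int[P]_w (N (x n w) `^ p) <= g * Q * (Ks * (2 `^ p * v n.+1 `^ p)).
  by rewrite ler_wpM2l // mulr_ge0 // ltW.
apply: le_trans (lerD (lerD (lexx _) hIa) hIs') _.
rewrite /K; set V := v n.+1 `^ p; set W := 2 `^ p.
by rewrite le_eqVlt; apply/orP; left; apply/eqP; ring.
Qed.

(** The Azema-Yor bound alone does not control the maximum; [azema_yor_control] recovers it at the
    price of the moment of [|x|]. *)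
Lemma rmax_bound : exists2 K : R, 0 <= K & forall n, (n1 <= n)%N ->
  \int[P]_w (rmax n w `^ p) <= K * v n `^ p.
Proof.
have [Ks Ks0 hKs] := moment_bound.
have [Ka Ka0 hKa] := azema_yor_bound.
set Q := 2 * (p * (2 * p) `^ (p - 1)).
have Q0 : 0 <= Q by rewrite /Q mulr_ge0 // mulr_ge0 // powR_ge0.
exists (2 * Ka + Q * Ks) => [|n hn]; first by apply: addr_ge0; apply: mulr_ge0.
have i1 := integZl 2 (integ_azema_yor n); have i2 := integZl Q (integ_x n).
apply: (@le_trans _ _ (\int[P]_w (2 * azema_yor p (rmax n w) (N (x n w)) + Q * N (x n w) `^ p))).
  apply: le_Rintegral => //; [exact: integ_rmax|exact: integD|].
  by move=> w _; apply: azema_yor_control => //; [exact: rmax_ge0|exact: ipnorm_ge0].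
rewrite RintegralD // !RintegralZl //; [|exact: integ_x|exact: integ_azema_yor].
have := hKs n hn; have := hKa n hn.
move=> h1 /(ler_wpM2l Q0) h2.
rewrite [X in _ <= X]mulrDl -[2 * Ka * _]mulrA -[Q * Ks * _]mulrA.
by apply: lerD => //; rewrite ler_wpM2l.
Qed.

Lemma rmax_powR_dec n w : (n1 <= n)%N ->
  (1 - p * a * gamma n.+1) * rmax n w `^ p <= rmax n.+1 w `^ p.
Proof.
move=> hn; have l01 := discount_ge0 hn; have /andP[l0 l1] := l01.
have g0 := ltW (hgamma (ltn0Sn n)).
apply: (@le_trans _ _ (((1 - a * gamma n.+1) * rmax n w) `^ p)).
  rewrite powRM ?rmax_ge0 // ler_wpM2r ?powR_ge0 // -mulrA.
  by apply: powR_bernoulli => //; rewrite mulr_ge0 //= ga.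
apply: ge0_lerpowR => //; first by rewrite mulr_ge0 // rmax_ge0.
by rewrite rmaxS // le_max lexx.
Qed.

(** * From the discounted maximum to the polynomially weighted supremum *)

Section WeightedSupremum.
Variables (c1 c2 eta1 eta2 eta : R).
Hypotheses (c10 : 0 < c1) (c20 : 0 < c2) (eta10 : 0 < eta1) (eta0 : 0 < eta)
  (hc1 : forall n, (n1 <= n)%N -> v n <= c1 / n%:R `^ eta1)
  (hc2 : forall n, (n1 <= n)%N -> gamma n <= c2 / n%:R `^ eta2)
  (heta2 : eta2 <= 1) (n10 : (0 < n1)%N).
Let delta := p * eta1 - (1 - eta2) - p * eta.
Hypothesis delta0 : 0 < delta.

Let rho (n : nat) : R := n%:R `^ (p * eta).

Let rho_ge0 n : 0 <= rho n.
Proof. exact: powR_ge0. Qed.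

Let rho_le n : 0 <= rho n <= rho n.+1.
Proof.
rewrite rho_ge0 /=; apply: ge0_lerpowR => //; first by rewrite mulr_ge0 // ltW.
by rewrite ler_nat.
Qed.

Let v_powR n : (n1 <= n)%N -> v n `^ p <= c1 `^ p * n%:R `^ (- (p * eta1)).
Proof.
move=> hn; have := ge0_lerpowR p0 (ltW (v0 hn)) (hc1 hn).
rewrite -powRN powRM ?powR_ge0 ?(ltW c10) // -powRrM mulNr (mulrC eta1).
by [].
Qed.

(** The exponents add up: [p eta - eta2 - p eta1 = -(1 + delta)]. The factor [2 ^ (p eta1)] accounts
    for [j + 1 <= 2 j]. *)
Lemma weighted_terms j : (n1 <= j)%N ->
  rho j.+1 * gamma j.+1 * v j `^ p <=
    c2 * (c1 `^ p * 2 `^ (p * eta1)) * j.+1%:R `^ (- (1 + delta)).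
Proof.
move=> hj.
have j0 : (0 < j)%N := leq_trans n10 hj.
have x0 : 0 < j%:R :> R by rewrite ltr0n.
have y0 : 0 < j.+1%:R :> R by rewrite ltr0n.
have yn0 : j.+1%:R != 0 :> R by rewrite gt_eqF.
have pe0 : 0 <= p * eta1 by rewrite mulr_ge0 // ltW.
have h1 : j%:R `^ (- (p * eta1)) <= 2 `^ (p * eta1) * j.+1%:R `^ (- (p * eta1)) :> R.
  rewrite !powRN ler_pdivlMr ?powR_gt0 // mulrC ler_pdivrMr ?powR_gt0 //.
  rewrite -powRM //; apply: ge0_lerpowR => //.
  by rewrite -natrM ler_nat mul2n -addnn -addn1 leq_add2l.
have h2 := v_powR hj.
have h3 := hc2 (leqW hj); rewrite -powRN in h3.
have cp0 := powR_ge0 c1 p.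
have h4 : v j `^ p <= c1 `^ p * (2 `^ (p * eta1) * j.+1%:R `^ (- (p * eta1))).
  by apply: (le_trans h2); rewrite ler_wpM2l.
have E : j.+1%:R `^ (- (1 + delta)) =
    rho j.+1 * j.+1%:R `^ (- eta2) * j.+1%:R `^ (- (p * eta1)) :> R.
  by rewrite /rho -!powRD ?yn0 ?implybT //; congr (_ `^ _); rewrite /delta; ring.
rewrite E.
rewrite [X in _ <= X](_ : _ = rho j.+1 * (c2 * j.+1%:R `^ (- eta2)) *
   (c1 `^ p * (2 `^ (p * eta1) * j.+1%:R `^ (- (p * eta1))))); last by ring.
apply: ler_pM => //.
- by rewrite mulr_ge0 ?rho_ge0 // ltW // hgamma.
- exact: powR_ge0.
- by rewrite ler_wpM2l.
Qed.

Lemma sup_bound : exists2 K : R, 0 < K & forall k0 : nat, (n1 <= k0)%N ->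
  (\int[P]_w ereal_sup [set (rho k * N (x k w) `^ p)%:E | k in [set k | (k0 <= k)%N]]
   <= (K * k0%:R `^ (- delta))%:E)%E.
Proof.
have [Kr Kr0 hKr] := rmax_bound.
have pa0 : 0 <= p * a by rewrite mulr_ge0.
pose B := c2 * (c1 `^ p * 2 `^ (p * eta1)).
have B0 : 0 <= B by rewrite /B mulr_ge0 ?(ltW c20) // mulr_ge0 ?powR_ge0.
pose K := c1 `^ p * Kr + p * a * (Kr * (B * delta^-1)).
have K0 : 0 <= K.
  have d0 : 0 <= delta^-1 by rewrite invr_ge0 ltW.
  apply: addr_ge0; apply: mulr_ge0 => //; first exact: powR_ge0.
  by apply: mulr_ge0 => //; exact: mulr_ge0.
(* [K] may vanish, while the constant must be positive. *)
exists (K + 1); first by rewrite ltr_wpDl.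
move=> k0 hk0.
have k00 : (0 < k0)%N := leq_trans n10 hk0.
pose G n w := rmax n w `^ p.
(* The majorant of [weighted_sup_le] with horizon [n] and rate [p * a]. *)
pose H n w := rho n * G n w + p * a * \sum_(k0 <= j < n) (rho j.+1 * gamma j.+1) * G j w.
have iH n : integ (H n).
  apply: integD; apply: integZl; first exact: integ_rmax.
  by apply: integ_sum => j; apply: integZl; exact: integ_rmax.
have H0 n w : 0 <= H n w.
  rewrite addr_ge0 ?mulr_ge0 ?rho_ge0 ?powR_ge0 //; apply: sumr_ge0 => j _.
  by rewrite !mulr_ge0 ?rho_ge0 ?powR_ge0 // ltW // hgamma.
have hH n : (k0 <= n)%N -> \int[P]_w (H n w) <= K * k0%:R `^ (- delta).
  move=> hn.
  have i1 : integ (fun w => rho n * G n w) by apply: integZl; exact: integ_rmax.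
  have i3 j : integ (fun w => (rho j.+1 * gamma j.+1) * G j w).
    by apply: integZl; exact: integ_rmax.
  have i2 : integ (fun w => \sum_(k0 <= j < n) (rho j.+1 * gamma j.+1) * G j w).
    exact: integ_sum.
  rewrite RintegralD //; last exact: integZl.
  rewrite !RintegralZl //; last exact: integ_rmax.
  have -> : \int[P]_w (\sum_(k0 <= j < n) (rho j.+1 * gamma j.+1) * G j w) =
     \sum_(k0 <= j < n) (rho j.+1 * gamma j.+1) * \int[P]_w G j w.
    rewrite Rintegral_sum //; apply: eq_bigr => j _.
    by rewrite RintegralZl //; exact: integ_rmax.
  rewrite /K mulrDl; apply: lerD.
    have n0 : (0 < n)%N := leq_trans k00 hn.
    apply: (@le_trans _ _ (rho n * (Kr * (c1 `^ p * n%:R `^ (- (p * eta1)))))).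
      rewrite ler_wpM2l ?rho_ge0 //; apply: (le_trans (hKr n (leq_trans hk0 hn))).
      by rewrite ler_wpM2l // v_powR // (leq_trans hk0).
    rewrite (_ : rho n * _ = c1 `^ p * Kr * (rho n * n%:R `^ (- (p * eta1)))); last by ring.
    apply: ler_wpM2l; first by rewrite mulr_ge0 ?powR_ge0.
    rewrite /rho -powRD; last by rewrite pnatr_eq0 -lt0n n0 implybT.
    (* The boundary term has exponent [p eta - p eta1 = - delta - (1 - eta2)], at most [- delta] by
       [eta2 <= 1]; then [n >= k0] concludes. *)
    apply: (@le_trans _ _ (n%:R `^ (- delta))).
      apply: ler_powR; first by rewrite ler1n.
      by move: heta2; rewrite /delta; lra.
    rewrite !powRN lef_pV2 ?posrE ?powR_gt0 ?ltr0n //.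
    by apply: ge0_lerpowR; rewrite ?(ltW delta0) // ler_nat.
  rewrite -[X in _ <= X]mulrA ler_wpM2l //.
  apply: (@le_trans _ _ (\sum_(k0 <= j < n) Kr * B * j.+1%:R `^ (- (1 + delta)))).
    rewrite big_nat [X in _ <= X]big_nat; apply: ler_sum => j /andP[kj _].
    have hj := leq_trans hk0 kj.
    have w0 : 0 <= rho j.+1 * gamma j.+1 by rewrite mulr_ge0 ?rho_ge0 // ltW // hgamma.
    apply: (@le_trans _ _ (Kr * (rho j.+1 * gamma j.+1 * v j `^ p))).
      by rewrite mulrCA ler_wpM2l // hKr.
    by rewrite -[X in _ <= X]mulrA ler_wpM2l // weighted_terms.
  rewrite -mulr_sumr -[Kr * B * _]mulrA -[Kr * _ * _]mulrA ler_wpM2l //.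
  by rewrite -[B * _ * _]mulrA ler_wpM2l // sum_powR_le.
pose S w := ereal_sup [set (rho k * N (x k w) `^ p)%:E | k in [set k | (k0 <= k)%N]].
have mH n : measurable_fun [set: T] (fun w => (H n w)%:E).
  exact: measurable_int (iH n).
have mS : measurable_fun [set: T] S.
  apply: (measurable_fun_esups (f := fun k w => (rho k * N (x k w) `^ p)%:E)) => k.
  apply/measurable_EFinP; apply: measurable_funM => //.
  apply: (measurableT_comp (measurable_powR p)).
  exact: (filtration_measurable_fun (@x_norm_measurable k)).
have mE : measurable_fun [set: T] (fun w => limn_einf (fun n => (H n w)%:E)).
  apply: measurableT_comp => //.
  apply: (measurable_fun_limn_esup (f := fun n w => (- (H n w)%:E)%E)) => n.
  exact: measurableT_comp.
have S0 w : (0 <= S w)%E.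
  apply: le_trans (ereal_sup_ubound _); last by exists k0 => /=.
  by rewrite lee_fin mulr_ge0 ?rho_ge0 ?powR_ge0.
(* For fixed [k], every [H n] with [n >= k] dominates the [k]-th term, hence so does the lower
   limit. *)
have SE w : (S w <= limn_einf (fun n => (H n w)%:E))%E.
  apply: ge_ereal_sup => _ [k /= hk <-].
  rewrite limn_einf_lim; apply: lime_ge; first exact: is_cvg_einfs.
  near=> m; apply: le_ereal_inf_tmp => _ [n /= mn <-].
  have kn : (k <= n)%N by apply: leq_trans mn; near: m; exists k.
  rewrite lee_fin.
  apply: (@le_trans _ _ (rho k * G k w)).
    by rewrite ler_wpM2l ?rho_ge0 // ge0_lerpowR ?ipnorm_ge0 // le_rmax.
  have := @weighted_sup_le R (p * a) gamma rho (G ^~ w) k0 n k pa0 rho_le.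
  apply; rewrite ?hk ?kn //.
  - by move=> i; exact: powR_ge0.
  - by move=> i _; rewrite ltW // hgamma.
  - by move=> i hi; apply: rmax_powR_dec; exact: leq_trans hi.
apply: (@le_trans _ _ (\int[P]_w limn_einf (fun n => (H n w)%:E))%E).
  by apply: ge0_le_integral => // w _; [exact: S0|exact: SE].
apply: le_trans (fatou P measurableT mH _) _.
  by move=> n w _; rewrite lee_fin.
rewrite limn_einf_lim; apply: lime_le; first exact: is_cvg_einfs.
near=> m; apply: (@le_trans _ _ (\int[P]_w (H m w)%:E)%E).
  by apply: ereal_inf_lbound; exists m => /=.
have hm : (k0 <= m)%N by near: m; exists k0.
rewrite -EFin_Rintegral // lee_fin; apply: (le_trans (hH m hm)).
by rewrite ler_wpM2r ?powR_ge0 // lerDl.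
Unshelve. all: by end_near. Qed.

End WeightedSupremum.

End Regime.

End DynamicalSystem.

(** * Extraction of the constants *)

Section EventualBounds.
Set Implicit Arguments.
Unset Strict Implicit.
Variable R : realType.

Lemma lty_real_bound (e : \bar R) : (e < +oo)%E -> exists2 r : R, 0 <= r & (e <= r%:E)%E.
Proof.
case: e => [r _|//|_]; last by exists 0; rewrite ?leNye.
by exists (Num.max r 0); [rewrite le_max lexx orbT|rewrite lee_fin le_max lexx].
Qed.

(** The upper limit is an infimum of suprema over neighbourhoods of infinity, so a strict inequality
    singles out one neighbourhood. *)
Lemma limn_esup_near (u : nat -> R) (c : \bar R) :
  (limn_esup (fun n => (u n)%:E) < c)%E ->
  exists2 e : \bar R, (e < c)%E & \forall n \near \oo, ((u n)%:E <= e)%E.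
Proof.
move=> /ereal_inf_lt[_ [V hV <-] h]; exists (ereal_sup [set (u x)%:E | x in V]) => //.
by apply: filterS hV => n Vn; apply: ereal_sup_ubound; exists n.
Qed.

Lemma limn_esup_lt_near (u : nat -> R) (l : R) :
  (limn_esup (fun n => (u n)%:E) < l%:E)%E ->
  exists2 r : R, r < l & \forall n \near \oo, u n <= r.
Proof.
move=> /limn_esup_near[[r| |]].
- by rewrite lte_fin => rl h; exists r => //; apply: filterS h => n; rewrite lee_fin.
- by rewrite ltNge leey.
move=> _ h; exists (l - 1); first by rewrite gtrBl.
by apply: filterS h => n; rewrite leeNy_eq.
Qed.

Lemma limn_esup_lty_near (u : nat -> R) :
  (limn_esup (fun n => (u n)%:E) < +oo)%E ->
  exists2 r : R, 0 <= r & \forall n \near \oo, u n <= r.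
Proof.
move=> /limn_esup_near[e /lty_real_bound[r r0 er] h]; exists r => //.
by apply: filterS h => n /le_trans /(_ er); rewrite lee_fin.
Qed.

Lemma cvg0_near_le (g : nat -> R) (c : R) : g n @[n --> \oo] --> (0 : R) -> 0 < c ->
  \forall n \near \oo, g n <= c.
Proof. by move=> hg c0; apply: filterS (cvgr_lt _ hg c c0) => n /ltW. Qed.

End EventualBounds.

Theorem theorem2p7 (R : realType) (p : R) (hp : 2 <= p)
  (disp : measure_display) (T : measurableType disp) (P : probability T R)
  (F : nat -> set (set T)) (hF : is_filtration F)
  (d : nat) (ip : {dot 'rV[R]_d for idfun})
  (f : 'rV[R]_d -> 'rV[R]_d) (hf : vec_measurable (@borel_rV R d) f)
  (thetas : 'rV[R]_d) (hzero : forall x : 'rV[R]_d, f x = 0 <-> x = thetas)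
  (gamma eps sigma : nat -> R)
  (hgamma : forall n, (0 < n)%N -> 0 < gamma n)
  (hgamma0 : gamma n @[n --> \oo] --> (0 : R))
  (heps : forall n, (0 < n)%N -> 0 <= eps n)
  (hsigma : forall n, (0 < n)%N -> 0 <= sigma n)
  (Rb : nat -> T -> 'rV[R]_d) (hRb : previsible F Rb)
  (D : nat -> T -> 'rV[R]_d) (hD : martingale_differences P F D)
  (theta0 : 'rV[R]_d) (theta : nat -> T -> 'rV[R]_d)
  (htheta : is_dynamical_system f gamma eps sigma Rb D theta0 theta)
  (v : nat -> R) (hv : forall n, v n = Num.sqrt (gamma n) * sigma n)
  (L L' : R) (hL : 0 < L) (hL' : 0 < L')
  (ha1 : forall x : 'rV[R]_d, ip (x - thetas) (f x) <= - L * ipnorm ip (x - thetas) ^+ 2)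
  (ha2 : forall x : 'rV[R]_d, ip (x - thetas) (f x) <= - L' * ipnorm ip (f x) ^+ 2)
  (hb1 : (ereal_sup [set ess_sup P (fun w => (ipnorm ip (Rb n w))%:E)
                    | n in [set n | (0 < n)%N]] < +oo)%E)
  (hb2 : (ereal_sup [set 'E_P[(fun w => ipnorm ip (D n w) `^ p)%R]
                    | n in [set n | (0 < n)%N]] < +oo)%E)
  (hvpos : forall n, (0 < n)%N -> 0 < v n)
  (c1 c2 eta1 eta2 : R) (hc1 : 0 < c1) (hc2 : 0 < c2) (heta1 : 0 < eta1)
  (heta2 : 0 < eta2) (heta2' : eta2 <= 1) (heta12 : (1 - eta2) / p < eta1)
  (hci : (limn_esup (fun n => (eps n / v n)%:E) < +oo)%E)
  (hcii1 : (limn_esup (fun n =>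
      ((gamma n)^-1 * ((v n.-1 - v n) / v n.-1))%:E) < L%:E)%E)
  (hcii2 : \forall n \near \oo, v n <= c1 / n%:R `^ eta1)
  (hciii : \forall n \near \oo, gamma n <= c2 / n%:R `^ eta2) :
  let etas := eta1 - (1 - eta2) / p in
  forall eta : R, 0 < eta -> eta < etas ->
  exists kappa : R, 0 < kappa /\
  exists n0 : nat, (0 < n0)%N /\
  forall k0 : nat, (n0 <= k0)%N ->
    ((\int[P]_w ereal_sup
        [set (k%:R `^ (p * eta) * ipnorm ip (theta k w - thetas) `^ p)%R%:E
        | k in [set k | (k0 <= k)%N]]) `^ p^-1
     <= (kappa * k0%:R `^ (- (etas - eta)))%:E)%E.
Proof.
move=> etas eta eta0 etaL.
have p0 : 0 < p by lra.
have [CR CR0 hCR'] := lty_real_bound hb1.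
have hCR n : (0 < n)%N -> {ae P, forall w, ipnorm ip (Rb n w) <= CR}.
  move=> n0; have : (ess_sup P (fun w => (ipnorm ip (Rb n w))%:E) <= CR%:E)%E.
    by apply: le_trans hCR'; apply: ereal_sup_ubound; exists n.
  by move=> /ess_supP; apply: filterS => w; rewrite lee_fin.
have [M M0 hM'] := lty_real_bound hb2.
have hM n : (0 < n)%N -> (\int[P]_w (ipnorm ip (D n w) `^ p)%:E <= M%:E)%E.
  move=> n0; apply: le_trans hM'; apply: ereal_sup_ubound; exists n => //.
  by rewrite unlock.
have [Ce Ce0 hCe] := limn_esup_lty_near hci.
have [r rL hr] := limn_esup_lt_near hcii1.
(* [r] may be negative, as [v] may grow; the maximum with [L / 2] keeps [L2] positive and still
   below [L]. *)
pose L2 := Num.max r (L / 2).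
have L20 : 0 < L2 by rewrite lt_max divr_gt0 ?orbT.
have L2L : L2 < L by rewrite gt_max rL /= ltr_pdivrMr // ltr_pMr // ltr1n.
pose L1 := (L2 + L) / 2.
have L21 : L2 < L1 by rewrite /L1; lra.
have L1L : L1 < L by rewrite /L1; lra.
have L10 : 0 < L1 by lra.
set A := 1 + p * L2; set a := A + p * (L'^-1 + Ce * CR) / (p - 1).
have a0 : 0 < a.
  have A0 : 0 < A by rewrite /A ltr_wpDr // mulr_ge0 // ltW.
  rewrite /a ltr_wpDr // divr_ge0 ?subr_ge0 //; last by lra.
  by rewrite mulr_ge0 ?(ltW p0) // addr_ge0 ?mulr_ge0 // invr_ge0 ltW.
have sm c : 0 < c -> \forall n \near \oo, gamma n <= c := cvg0_near_le hgamma0.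
have h1 := sm 1 ltr01.
have h2 : \forall n \near \oo, gamma n <= L1^-1 by apply: sm; rewrite invr_gt0.
have h3 : \forall n \near \oo, gamma n <= 2^-1 / L2 by apply: sm; rewrite divr_gt0 // invr_gt0.
have h4 : \forall n \near \oo, gamma n <= 2 * L' * (L - L1) / L.
  by apply: sm; rewrite divr_gt0 // mulr_gt0 ?subr_gt0 // mulr_gt0.
have h5 : \forall n \near \oo, gamma n <= a^-1 by apply: sm; rewrite invr_gt0.
have [n1 n10 hn1] : exists2 n1 : nat, (0 < n1)%N & forall n, (n1 <= n)%N ->
    [/\ gamma n <= 1, gamma n * L1 <= 1, gamma n * L2 <= 2^-1,
        gamma n * L <= 2 * L' * (L - L1) & a * gamma n <= 1] /\
    [/\ (gamma n)^-1 * ((v n.-1 - v n) / v n.-1) <= r, eps n / v n <= Ce,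
        v n <= c1 / n%:R `^ eta1 & gamma n <= c2 / n%:R `^ eta2].
  have : \forall n \near \oo,
    [/\ gamma n <= 1, gamma n * L1 <= 1, gamma n * L2 <= 2^-1,
        gamma n * L <= 2 * L' * (L - L1) & a * gamma n <= 1] /\
    [/\ (gamma n)^-1 * ((v n.-1 - v n) / v n.-1) <= r, eps n / v n <= Ce,
        v n <= c1 / n%:R `^ eta1 & gamma n <= c2 / n%:R `^ eta2].
    near=> n; split; split.
    - by near: n.
    - by rewrite -ler_pdivlMr // mul1r; near: n.
    - by rewrite -ler_pdivlMr //; near: n.
    - by rewrite -ler_pdivlMr //; near: n.
    - by rewrite mulrC -ler_pdivlMr // mul1r; near: n.
    - by near: n.
    - by near: n.
    - by near: n.
    - by near: n.
  move=> [m _ hm]; exists m.+1 => // n mn; apply: hm => /=.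
  exact: ltnW.
pose delta := p * eta1 - (1 - eta2) - p * eta.
have deltaE : delta = p * (etas - eta) by rewrite /delta /etas; field; rewrite gt_eqF.
have delta0 : 0 < delta by rewrite deltaE mulr_gt0 // subr_gt0.
(* The decay condition is read at [n.+1], whose predecessor is [n], and cleared of its positive
   denominators. *)
have vdec n : (n1 <= n)%N -> (1 - gamma n.+1 * L2) * v n <= v n.+1.
  move=> hn; have [_ [hrn _ _ _]] := hn1 n.+1 (leqW hn).
  have g0 := hgamma n.+1 (ltn0Sn n); have v0 := hvpos n (leq_trans n10 hn).
  move: hrn; rewrite /= mulrC ler_pdivrMr // ler_pdivrMr // => h.
  have rL2 : r <= L2 by rewrite le_max lexx.
  have : r * gamma n.+1 * v n <= L2 * gamma n.+1 * v n.
    by rewrite ler_wpM2r ?(ltW v0) // ler_wpM2r // ltW.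
  by lra.
have hev n : (n1 <= n)%N -> eps n.+1 <= Ce * v n.+1.
  move=> hn; have [_ [_ h _ _]] := hn1 n.+1 (leqW hn).
  by rewrite -ler_pdivrMr // hvpos.
have [K K0 hK] := sup_bound hp hF hf hgamma heps hsigma hRb hD htheta hv hL hL' ha1 ha2
  CR0 M0 hCR hM L20 L21 L1L Ce0
  (fun n hn => let: conj (And5 h _ _ _ _) _ := hn1 n.+1 (leqW hn) in h)
  (fun n hn => let: conj (And5 _ h _ _ _) _ := hn1 n.+1 (leqW hn) in h)
  (fun n hn => let: conj (And5 _ _ h _ _) _ := hn1 n.+1 (leqW hn) in h)
  (fun n hn => let: conj (And5 _ _ _ h _) _ := hn1 n.+1 (leqW hn) in h)
  (fun n hn => let: conj (And5 _ _ _ _ h) _ := hn1 n.+1 (leqW hn) in h)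
  (fun n hn => hvpos n (leq_trans n10 hn)) vdec hev hc1 hc2 heta1 eta0
  (fun n hn => let: conj _ (And4 _ _ h _) := hn1 n hn in h)
  (fun n hn => let: conj _ (And4 _ _ _ h) := hn1 n hn in h)
  heta2' n10 delta0.
exists (K `^ p^-1); split; first by rewrite powR_gt0.
exists n1; split => // k0 hk0.
have ip0 : 0 <= p^-1 by rewrite invr_ge0 ltW.
have -> : (K `^ p^-1 * k0%:R `^ (- (etas - eta)))%:E = ((K * k0%:R `^ (- delta))%:E `^ p^-1)%E.
  rewrite poweR_EFin powRM ?powR_ge0 ?(ltW K0) // -powRrM; congr (_ * _ `^ _)%:E.
  by rewrite -/delta deltaE; field; rewrite gt_eqF.
have := hK k0 hk0; set I := (\int[P]_w _)%E => hI.
have I0 : (0 <= I)%E.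
  apply: integral_ge0 => w _; apply: le_trans (ereal_sup_ubound _); last by exists k0 => /=.
  by rewrite lee_fin mulr_ge0 ?powR_ge0.
apply: gt0_ler_poweR => //; rewrite in_itv /= leey andbT //.
by rewrite lee_fin mulr_ge0 ?powR_ge0 // ltW.
Unshelve. all: by end_near. Qed.
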